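(* There exists a constant $C>0$ such that for all $f\in H^{\log}(\mathbb{T})$ $$\sum_{n\in\mathbb{Z}\setminus\{0\}}\frac{\Psi_0(|n\widehat{f}(n)|)}{n^2}\le C\int_{\mathbb{T}}\Psi_0(f^*(\theta))\,d\theta,$$ where $\Psi_0(t):=t\,[\log(e+t)]^{-1}$, $t\ge0$.
   Context: $\mathbb{T}=\mathbb{R}/2\pi\mathbb{Z}$; $\mathcal{D}'$ is the space of distributions on $\mathbb{T}$. For $f\in\mathcal{D}'$ and $n\in\mathbb{Z}$, $\widehat{f}(n):=\langle f,e_n\rangle$ with $e_n(\theta):=e^{in\theta}$. $f^*$ denotes the non-tangential maximal function of $f\in\mathcal{D}'$: $f^*(\theta)$ is the supremum of $|u|$ over a non-tangential approach (Stolz) region of fixed aperture in the unit disc with vertex $e^{i\theta}$, where $u$ is the Poisson extension of $f$ to the disc. $H^{\log}(\mathbb{T})$ is the class of all $f\in\mathcal{D}'$ with $\int_0^{2\pi}\Psi_0(f^*(\theta))\,d\theta<\infty$. *)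

(* Defs.v *)
From HB Require Import structures.
From mathcomp Require Import all_boot all_order all_algebra.
From mathcomp Require Import complex.
From mathcomp Require Import all_classical all_reals all_analysis.

Set Implicit Arguments.
Unset Strict Implicit.
Unset Printing Implicit Defensive.

Import Order.TTheory GRing.Theory Num.Theory.
Import numFieldNormedType.Exports.
Import ComplexField.Normc.

Local Open Scope classical_set_scope.
Local Open Scope ring_scope.
Local Open Scope complex_scope.

Definition smooth (R : realType) (g : R -> R) : Prop :=
  forall (k : nat) (t : R), derivable (derive1n k g) t 1.

(* The [k]-th derivative of a complex-valued function of a real variable. *)
Definition cderiven (R : realType) (k : nat) (phi : R -> R[i]) (t : R) : R[i] :=
  derive1n k (fun s => complex.Re (phi s)) t +i*
  derive1n k (fun s => complex.Im (phi s)) t.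

(* Functions on the circle R / 2 pi Z are 2 pi-periodic functions on R; this is
   C^oo of the circle with complex values. *)
Definition smooth_circle (R : realType) : {pred R -> R[i]} :=
  fun phi => `[< [/\ periodic phi (pi *+ 2),
                     smooth (fun t => complex.Re (phi t)) &
                     smooth (fun t => complex.Im (phi t))] >].

Lemma derive1n_lin (R : realType) (a b : R) (g h : R -> R) k :
  smooth g -> smooth h ->
  derive1n k (fun t => a * g t + b * h t) =
  (fun t => a * derive1n k g t + b * derive1n k h t).
Proof.
move=> sg sh; elim: k => [//|k IH]; rewrite !derive1nS IH.
apply/funext => t.
have dg : derivable (derive1n k g) t 1 by exact: sg.
have dh : derivable (derive1n k h) t 1 by exact: sh.
rewrite !derive1E deriveD; [|exact: derivableZ|exact: derivableZ].
by rewrite !deriveZ.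
Qed.

Lemma smooth_lin (R : realType) (a b : R) (g h : R -> R) :
  smooth g -> smooth h -> smooth (fun t => a * g t + b * h t).
Proof.
move=> sg sh k t; rewrite derive1n_lin//.
by apply: derivableD; apply: derivableZ; [exact: sg|exact: sh].
Qed.

Lemma smooth0 (R : realType) : smooth (fun _ : R => 0 : R).
Proof.
move=> k t; suff -> : derive1n k (fun _ : R => 0 : R) = (fun _ => 0).
  exact: derivable_cst.
elim: k => [//|k IH]; rewrite derive1nS IH; apply/funext => s.
by rewrite derive1_cst.
Qed.

Lemma smooth_circle_submod (R : realType) : submod_closed (@smooth_circle R).
Proof.
split; first by apply/asboolP; split=> [t||] //; exact: smooth0.
move=> a phi psi /asboolP[p1 r1 i1] /asboolP[p2 r2 i2]; apply/asboolP; split.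
- by move=> t; rewrite /= !fctE p1 p2.
- have H := @smooth_lin _ 1 1 _ _
    (@smooth_lin _ (complex.Re a) (- complex.Im a) _ _ r1 i1) r2.
  apply: (eq_ind _ (@smooth R) H); apply/funext => t; rewrite {H} !fctE.
  by case: a (phi t) (psi t) => [? ?] [? ?] [? ?] /=; rewrite !mul1r mulNr.
- have H := @smooth_lin _ 1 1 _ _
    (@smooth_lin _ (complex.Re a) (complex.Im a) _ _ i1 r1) i2.
  apply: (eq_ind _ (@smooth R) H); apply/funext => t; rewrite {H} !fctE.
  by case: a (phi t) (psi t) => [? ?] [? ?] [? ?] /=; rewrite !mul1r.
Qed.

HB.instance Definition _ (R : realType) :=
  GRing.isSubmodClosed.Build R[i] (R -> R[i]) (@smooth_circle R)
    (@smooth_circle_submod R).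

Record testfun (R : realType) := TestFun {
  tf_val :> R -> R[i] ;
  tf_smooth : tf_val \in @smooth_circle R }.

HB.instance Definition _ (R : realType) := [isSub for @tf_val R].
HB.instance Definition _ (R : realType) := [Choice of testfun R by <:].
HB.instance Definition _ (R : realType) :=
  [SubChoice_isSubLmodule of testfun R by <:].

(* The supremum is that of a bounded set, by periodicity and smoothness. *)
Definition seminorm (R : realType) (k : nat) (phi : testfun R) : R :=
  sup (range (fun t => normc (cderiven k phi t))).

(* Continuity of a linear functional for the Frechet topology that these
   seminorms define on C^oo of the circle. *)
Definition dist_continuous (R : realType) (f : testfun R -> R[i]) : Prop :=
  exists (N : nat) (K : R), forall phi : testfun R,
    normc (f phi) <= K * \sum_(k < N.+1) seminorm k phi.

Record circle_dist (R : realType) := CircleDist {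
  pairing :> {scalar testfun R} ;
  pairing_continuous : dist_continuous pairing }.

Definition expi (R : realType) (t : R) : R[i] := cos t +i* sin t.

(* A class of smooth functions stable under differentiation. *)
Inductive elementary (R : realType) : (R -> R) -> Prop :=
| elem_cst c : elementary (fun _ => c)
| elem_cos c : elementary (fun t => cos (c * t))
| elem_sin c : elementary (fun t => sin (c * t))
| elem_add g h : elementary g -> elementary h ->
    elementary (fun t => g t + h t)
| elem_mul g h : elementary g -> elementary h ->
    elementary (fun t => g t * h t)
| elem_inv g : elementary g -> (forall t, g t != 0) ->
    elementary (fun t => (g t)^-1).

Lemma elementary_derive (R : realType) (g : R -> R) : elementary g ->
  exists2 g' : R -> R, elementary g' & forall t : R, is_derive t 1 g (g' t).
Proof.
have lin (c t : R) : is_derive t 1 (fun s : R => c * s) c.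
  have := is_deriveZ c (is_derive_id t (1 : R)).
  by rewrite /GRing.scale/= mulr1.
elim=> {g} [c|c|c|g h _ [g' eg dg] _ [h' eh dh]|g h elg [g' eg dg] elh [h' eh dh]
  |g elg [g' eg dg] g0].
- by exists (fun=> 0) => [|t]; [exact: elem_cst|exact: is_derive_cst].
- exists (fun t => - c * sin (c * t)).
    by apply: elem_mul; [exact: elem_cst|exact: elem_sin].
  move=> t; have := is_derive1_comp (is_derive_cos (c * t)) (lin c t).
  by rewrite mulrC mulrN -mulNr.
- exists (fun t => c * cos (c * t)).
    by apply: elem_mul; [exact: elem_cst|exact: elem_cos].
  move=> t; have := is_derive1_comp (is_derive_sin (c * t)) (lin c t).
  by rewrite mulrC.
- by exists (fun t => g' t + h' t) => [|t]; [exact: elem_add|exact: is_deriveD].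
- exists (fun t => g t * h' t + h t * g' t).
    by apply: elem_add; exact: elem_mul.
  by move=> t; exact: is_deriveM.
- exists (fun t => -1 * ((g t)^-1 * (g t)^-1) * g' t).
    apply: elem_mul => //; apply: elem_mul; first exact: elem_cst.
    by apply: elem_mul; exact: elem_inv.
  move=> t; rewrite mulN1r -invfM.
  have := is_deriveV (g0 t) (dg t).
  by rewrite /GRing.scale/= expr2.
Qed.

Lemma elementary_smooth (R : realType) (g : R -> R) : elementary g -> smooth g.
Proof.
move=> eg k t; suff /elementary_derive[g' _ dg] : elementary (derive1n k g) by [].
elim: k => [//|k /elementary_derive[g' eg' dg]].
rewrite derive1nS (_ : _^`()%classic = g')//.
by apply/funext => s; rewrite derive1E; exact: derive_val.
Qed.

Lemma expi_int_subproof (R : realType) (n : int) :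
  (fun t : R => expi (n%:~R * t)) \in @smooth_circle R.
Proof.
apply/asboolP; split; [|exact/elementary_smooth/elem_cos
                       |exact/elementary_smooth/elem_sin].
have key (m : nat) (t : R) : expi (m%:R * (t + pi *+ 2)) = expi (m%:R * t).
  rewrite /expi mulrDr [_ * (pi *+ 2)]mulr_natl.
  by rewrite (periodicn (@cosD2pi R)) (periodicn (@sinD2pi R)).
move=> t; case: n => m; first exact: key.
rewrite NegzE mulrNz !mulNr /expi !cosN !sinN.
by have [-> ->] := key m.+1 t.
Qed.

Definition expi_int (R : realType) (n : int) : testfun R :=
  TestFun (@expi_int_subproof R n).

Definition fourier_coef (R : realType) (f : circle_dist R) (n : int) : R[i] :=
  f (expi_int R n).

Record disc (R : realType) := Disc {
  disc_val :> R[i] ;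
  disc_lt1 : normc disc_val < 1 }.

Lemma poisson_kernel_subproof (R : realType) (z : disc R) :
  (fun t : R => ((1 - normc z ^+ 2) / normc (expi t - (z : R[i])) ^+ 2)%:C)
    \in @smooth_circle R.
Proof.
apply/asboolP; split.
- by move=> t; rewrite /expi cosD2pi sinD2pi.
- apply: elementary_smooth => /=.
  case: z => -[x y] /= z1.
  have sqE t : normc (expi t - (x +i* y)) ^+ 2 =
      (cos (1 * t) + - x) * (cos (1 * t) + - x) +
      (sin (1 * t) + - y) * (sin (1 * t) + - y) :> R.
    by rewrite /= sqr_sqrtr ?addr_ge0 ?sqr_ge0// !mul1r !expr2.
  under eq_fun do rewrite sqE.
  apply: elem_mul; first exact: elem_cst.
  apply: elem_inv.
    by apply: elem_add; apply: elem_mul; apply: elem_add;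
      (exact: elem_cst || exact: elem_cos || exact: elem_sin).
  move=> t; rewrite -sqE sqrf_eq0; apply/eqP => /eq0_normc/eqP.
  rewrite subr_eq0 => /eqP zE; move: z1.
  by case: zE => <- <-; rewrite cos2Dsin2 sqrtr1 ltxx.
- exact: smooth0.
Qed.

Definition poisson_kernel (R : realType) (z : disc R) : testfun R :=
  TestFun (poisson_kernel_subproof z).

(* A function g is the distribution phi |-> (2 pi)^-1 \int_0^(2 pi) g phi: with
   this normalisation the Poisson extension carries no factor (2 pi)^-1, and
   the constant function 1 extends to 1. *)
Definition poisson_ext (R : realType) (f : circle_dist R) (z : disc R) : R[i] :=
  f (poisson_kernel z).

(* The vertex is e^(i theta); the region is empty unless alpha > 1. *)
Definition stolz (R : realType) (alpha theta : R) : set (disc R) :=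
  [set z | normc (expi theta - (z : R[i])) < alpha * (1 - normc z)].

Definition nt_max (R : realType) (alpha : R) (f : circle_dist R) (theta : R) :
    \bar R :=
  ereal_sup [set (normc (poisson_ext f z))%:E | z in stolz alpha theta].

Definition Psi0 (R : realType) (t : R) : R := t / ln (expR 1 + t).

(* [er_map] extends Psi0 to \bar R with Psi0 +oo = +oo. *)
Definition Hlog (R : realType) (alpha : R) : set (circle_dist R) :=
  [set f | (\int[@lebesgue_measure R]_(theta in `[0%R, (pi *+ 2)%R])
              er_map (@Psi0 R) (nt_max alpha f theta) < +oo)%E].

(* Main.v *)
(* Write [c_n] for the Fourier coefficients of [f], [u] for its Poisson
   extension and [g] for its nontangential maximal function.  Fix a level [l]
   and take [s] slightly larger than a multiple of the measure of [g > l].  On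
   the circle of radius [1 - s] every point lies in the Stolz region of some
   vertex where [g <= l], so there [|u| <= min (g, l)], and Bessel's inequality
   bounds the sum of [|c_n|^2] over [|n| <= 1 / (2 s)] by a multiple of the
   integral of [min (g, l)^2].  The remaining [n] carry a mass of [n^-2] at most
   of order [s].  Hence the mass of [n^-2] on [|n c_n| > l] is at most a multiple
   of the integral of [min (g / l, 1)^2], with no Calderon-Zygmund decomposition.
   Summing over dyadic levels against [Psi0] gives the inequality, because
   [Psi0 t] grows at least like a positive power of [t] and at most like [t]. *)

Require Import Defs.
From mathcomp Require Import all_boot all_order all_algebra.
From mathcomp Require Import complex.
From mathcomp Require Import all_classical all_reals all_analysis.
From mathcomp Require Import measurable_realfun.
From mathcomp Require Import ring lra zify.
Import Order.TTheory GRing.Theory Num.Theory.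
Import numFieldNormedType.Exports.
Import ComplexField.Normc.
Local Open Scope classical_set_scope.
Local Open Scope ring_scope.

(** * Derivatives of the Poisson kernel *)

(** The reciprocal of |e^(it) - r|^2; the Poisson kernel at radius [r] is this function, shifted,
    times the constant 1 - r^2. *)
Definition inv_poisson (R : realType) (r t : R) : R :=
  (1 - 2 * r * cos t + r ^+ 2)^-1.

Lemma poisson_denom_ge (R : realType) (r t : R) : 0 <= r ->
  (1 - r) ^+ 2 <= 1 - 2 * r * cos t + r ^+ 2.
Proof. by move=> r0; have := cos_le1 t; nra. Qed.

Lemma poisson_denom_gt0 (R : realType) (r t : R) : 0 <= r < 1 ->
  0 < 1 - 2 * r * cos t + r ^+ 2.
Proof.
move=> /andP[r0 r1]; apply: lt_le_trans (poisson_denom_ge _ _ _ r0).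
by rewrite exprn_gt0// subr_gt0.
Qed.

(* An algebra of bounded functions stable under differentiation: it controls
   all derivatives of the remainder of the Poisson series. *)
Inductive poisson_algebra (R : realType) (r : R) : (R -> R) -> Prop :=
| pa_cst c : poisson_algebra R r (fun _ => c)
| pa_cos : poisson_algebra R r (fun t => cos (1 * t))
| pa_sin : poisson_algebra R r (fun t => sin (1 * t))
| pa_inv : poisson_algebra R r (inv_poisson R r)
| pa_add g h : poisson_algebra R r g -> poisson_algebra R r h ->
    poisson_algebra R r (fun t => g t + h t)
| pa_mul g h : poisson_algebra R r g -> poisson_algebra R r h ->
    poisson_algebra R r (fun t => g t * h t).

Section PoissonAlgebra.
Context {R : realType} (r : R) (r01 : 0 <= r < 1).

Let is_derive_lin (c t : R) : is_derive t 1 (fun s : R => c * s) c.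
Proof.
have := is_deriveZ c (is_derive_id t (1 : R)).
by rewrite /GRing.scale/= mulr1.
Qed.

Lemma is_derive_cos_lin (c t : R) :
  is_derive t 1 (fun s : R => cos (c * s)) (- c * sin (c * t)).
Proof.
have := is_derive1_comp (is_derive_cos (c * t)) (is_derive_lin c t).
by rewrite mulrC mulrN -mulNr.
Qed.

Lemma is_derive_sin_lin (c t : R) :
  is_derive t 1 (fun s : R => sin (c * s)) (c * cos (c * t)).
Proof.
have := is_derive1_comp (is_derive_sin (c * t)) (is_derive_lin c t).
by rewrite mulrC.
Qed.

Lemma poisson_algebra_derive g : poisson_algebra R r g ->
  exists2 g', poisson_algebra R r g' & forall t : R, is_derive t 1 g (g' t).
Proof.
elim=> {g} [c||||g h pg [g' pg' dg] ph [h' ph' dh]|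
  g h pg [g' pg' dg] ph [h' ph' dh]].
- by exists (fun=> 0) => [|t]; [exact: pa_cst|exact: is_derive_cst].
- exists (fun t => - 1 * sin (1 * t)); last exact: is_derive_cos_lin.
  by apply: pa_mul; [exact: pa_cst|exact: pa_sin].
- exists (fun t => 1 * cos (1 * t)); last exact: is_derive_sin_lin.
  by apply: pa_mul; [exact: pa_cst|exact: pa_cos].
- exists (fun t => - (2 * r) * (sin (1 * t) *
                   (inv_poisson R r t * inv_poisson R r t))).
    apply: pa_mul; first exact: pa_cst.
    by apply: pa_mul; [exact: pa_sin|apply: pa_mul; exact: pa_inv].
  move=> t; pose D s := 1 - 2 * r * cos s + r ^+ 2.
  have D0 : D t != 0 by rewrite gt_eqF// poisson_denom_gt0.
  have dD : is_derive t 1 D (2 * r * sin t).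
    rewrite (_ : D = (cst (1 + r ^+ 2) \+ (- (2 * r)) \*: cos)); last first.
      by apply/funext => s /=; rewrite /D /GRing.scale/=; ring.
    apply: is_derive_eq.
    by rewrite add0r /GRing.scale/=; ring.
  have := is_deriveV D0 dD; rewrite /GRing.scale/= => H.
  apply: (is_derive_eq (f := inv_poisson R r) H).
  by rewrite mul1r /inv_poisson -/(D t); field.
- by exists (fun t => g' t + h' t) => [|t]; [exact: pa_add|exact: is_deriveD].
- exists (fun t => g t * h' t + h t * g' t); last by move=> t; exact: is_deriveM.
  by apply: pa_add; exact: pa_mul.
Qed.

Lemma poisson_algebra_elementary g : poisson_algebra R r g -> elementary g.
Proof.
elim=> {g} [c||||g h _ eg _ eh|g h _ eg _ eh].
- exact: elem_cst.
- exact: elem_cos.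
- exact: elem_sin.
- apply: (@elem_inv _ (fun t => 1 - 2 * r * cos t + r ^+ 2)).
    rewrite (_ : (fun t => _) = (fun t : R => 1 + (- (2 * r)) * cos (1 * t) + r ^+ 2)).
      apply: elem_add; last exact: elem_cst.
      apply: elem_add; first exact: elem_cst.
      by apply: elem_mul; [exact: elem_cst|exact: elem_cos].
    by apply/funext => t; rewrite mul1r mulNr.
  by move=> t; rewrite gt_eqF// poisson_denom_gt0.
- exact: elem_add.
- exact: elem_mul.
Qed.

Lemma poisson_algebra_bounded g : poisson_algebra R r g ->
  exists C : R, forall t, `|g t| <= C.
Proof.
elim=> {g} [c||||g h _ [C gC] _ [D hD]|g h _ [C gC] _ [D hD]].
- by exists `|c|.
- by exists 1 => t; rewrite ler_norml cos_le1 cos_geN1.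
- by exists 1 => t; rewrite ler_norml sin_le1 sin_geN1.
- have /andP[r0 r1] := r01.
  exists (((1 - r) ^+ 2)^-1) => t.
  rewrite ger0_norm ?invr_ge0 ?(ltW (poisson_denom_gt0 _ _ _ r01))//.
  rewrite lef_pV2 ?posrE ?poisson_denom_gt0//; last by rewrite exprn_gt0 ?subr_gt0.
  exact: poisson_denom_ge.
- by exists (C + D) => t; rewrite (le_trans (ler_normD _ _))// lerD.
- by exists (C * D) => t; rewrite normrM ler_pM.
Qed.

(** A derivative either falls on the trigonometric factor and costs a factor [m], or replaces [g] by
    an element of the same algebra, which is bounded. Hence [C] depends on [g] and [k] but not on
    [m]. Cosine and sine go together since differentiation exchanges them. *)
Lemma derive1n_modulated_le g k : poisson_algebra R r g ->
  exists C : R, forall (m : nat) (t : R),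
    `|derive1n k (fun s => cos (m%:R * s) * g s) t| <= C * m.+1%:R ^+ k /\
    `|derive1n k (fun s => sin (m%:R * s) * g s) t| <= C * m.+1%:R ^+ k.
Proof.
elim: k g => [|k IH] g pg.
  have [C gC] := poisson_algebra_bounded g pg.
  exists C => m t; rewrite !derive1n0 expr0 mulr1 !normrM; split.
    rewrite -[leRHS]mul1r ler_pM// ler_norml cos_le1 cos_geN1//.
  by rewrite -[leRHS]mul1r ler_pM// ler_norml sin_le1 sin_geN1.
have [g' pg' dg] := poisson_algebra_derive g pg.
have [C gC] := IH _ pg; have [D gD] := IH _ pg'.
have sm h m : poisson_algebra R r h ->
    smooth (fun s => cos (m%:R * s) * h s) /\ smooth (fun s => sin (m%:R * s) * h s).
  move=> /poisson_algebra_elementary eh; split; apply: elementary_smooth;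
    by apply: elem_mul => //; (exact: elem_cos || exact: elem_sin).
exists (C + D) => m t.
have C0 : 0 <= C.
  by have [+ _] := gC 0%N 0; rewrite expr1n mulr1; exact: le_trans.
have D0 : 0 <= D.
  by have [+ _] := gD 0%N 0; rewrite expr1n mulr1; exact: le_trans.
have m1 : 1 <= m.+1%:R :> R by rewrite ler1n.
have mm : m%:R <= m.+1%:R :> R by rewrite ler_nat.
have Mk0 : 0 <= m.+1%:R ^+ k :> R by rewrite exprn_ge0.
have bnd x y : `|x| <= C * m.+1%:R ^+ k -> `|y| <= D * m.+1%:R ^+ k ->
    m%:R * `|x| + `|y| <= (C + D) * m.+1%:R ^+ k.+1.
  move=> xC yD; rewrite mulrDl exprS lerD//.
    rewrite mulrCA; apply: ler_pM => //.
  apply: (le_trans yD); rewrite ler_wpM2l// ler_peMl//.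
have [sc ss] := sm _ m pg; have [sc' ss'] := sm _ m pg'.
have [gc gs] := gC m t; have [gc' gs'] := gD m t.
(* Carrying out the innermost derivative first leaves [k] derivatives of modulated functions, so the
   bounds for [g] and [g'] both apply. *)
split; rewrite /derive1n iterSr -/(derive1n k _).
- rewrite (_ : derive1 _ =
    fun s => - m%:R * (sin (m%:R * s) * g s) + 1 * (cos (m%:R * s) * g' s)).
    rewrite derive1n_lin// mul1r (le_trans (ler_normD _ _))//.
    rewrite normrM normrN normr_nat; exact: bnd.
  apply/funext => s; rewrite derive1E.
  have H := is_deriveM (is_derive_cos_lin m%:R s) (dg s).
  by rewrite (derive_val (is_derive := H)) /GRing.scale/=; ring.
- rewrite (_ : derive1 _ =
    fun s => m%:R * (cos (m%:R * s) * g s) + 1 * (sin (m%:R * s) * g' s)).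
    rewrite derive1n_lin// mul1r (le_trans (ler_normD _ _))//.
    rewrite normrM normr_nat; exact: bnd.
  apply/funext => s; rewrite derive1E.
  have H := is_deriveM (is_derive_sin_lin m%:R s) (dg s).
  by rewrite (derive_val (is_derive := H)) /GRing.scale/=; ring.
Qed.

End PoissonAlgebra.

Lemma derive1n_shift (R : realType) (g : R -> R) (a : R) k :
  derive1n k (fun t => g (t - a)) = (fun t => derive1n k g (t - a)).
Proof.
elim: k => [//|k IH]; rewrite !derive1nS IH; apply/funext => t.
rewrite /derive1.
suff -> : (fun h : R => h^-1 *: (derive1n k g (h + t - a) - derive1n k g (t - a)))
  = (fun h : R => h^-1 *: (derive1n k g (h + (t - a)) - derive1n k g (t - a))) by [].
by apply/funext => h; rewrite addrA.
Qed.

(** Each of the [n.+1] terms of 1 + r + ... + r^n is at least r^n. *)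
Lemma natr_geometric_le1 (R : realFieldType) (r : R) (n : nat) : 0 <= r <= 1 ->
  n.+1%:R * (1 - r) * r ^+ n <= 1 - r ^+ n.+1.
Proof.
move=> /andP[r0 r1]; elim: n => [|n IH]; first by rewrite expr0 expr1 mulr1 mul1r.
have rn1 : r ^+ n.+1 <= 1 by rewrite exprn_ile1.
move: IH rn1; rewrite -(natr1 n.+1) !exprS; set x := r ^+ n; set y := n.+1%:R.
nra.
Qed.

Lemma natr_exp_geometric_bounded (R : realType) (r : R) (k : nat) :
  0 <= r < 1 -> exists2 B : R, 0 <= B & forall n, n.+1%:R ^+ k * r ^+ n <= B.
Proof.
elim: k r => [|k IH] r r01; have /andP[r0 r1] := r01.
  by exists 1 => // n; rewrite expr0 mul1r exprn_ile1// ltW.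
(* Since r^n = q^n q^n, one factor q^n absorbs the [k]-th power by induction and the other absorbs
   the extra factor [n.+1]. *)
pose q := Num.sqrt r.
have q01 : 0 <= q < 1 by rewrite sqrtr_ge0 -sqrtr1 ltr_sqrt.
have /andP[q0 q1] := q01.
have [B B0 HB] := IH _ q01.
exists ((1 - q)^-1 * B) => [|n]; first by rewrite mulr_ge0// invr_ge0 subr_ge0 ltW.
rewrite -(sqr_sqrtr r0) -/q -exprM mul2n -addnn exprD exprS.
rewrite mulrACA ler_pM// ?mulr_ge0 ?exprn_ge0//.
rewrite -[leRHS]mul1r ler_pdivlMr ?subr_gt0// mulrAC.
have q01' : 0 <= q <= 1 by rewrite q0 ltW.
apply: (le_trans (natr_geometric_le1 _ _ _ q01')).
by rewrite lerBlDr lerDl exprn_ge0.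
Qed.

(** Boundedness with the exponent [k.+1] makes the product with exponent [k] of order 1/n. *)
Lemma natr_exp_geometric (R : realType) (r C e : R) (k n0 : nat) :
  0 <= r < 1 -> 0 < e ->
  exists2 n, (n0 <= n)%N & C * n.+1%:R ^+ k * r ^+ n <= e.
Proof.
move=> r01 e0; have /andP[r0 r1] := r01.
have [B B0 HB] := natr_exp_geometric_bounded _ r k.+1 r01.
pose n1 := Num.truncn (`|C| * B / e).
have [nn1 n0n] : (n1 <= maxn n0 n1 /\ n0 <= maxn n0 n1)%N.
  by rewrite leq_maxl leq_maxr.
exists (maxn n0 n1) => //; set n := maxn _ _ in nn1 n0n *.
have nB : `|C| * B / e <= n.+1%:R.
  by apply/ltW/(lt_le_trans (truncnS_gt _)); rewrite ler_nat ltnS.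
have n0' : 0 < n.+1%:R :> R by rewrite ltr0n.
rewrite ler_pdivrMr// in nB.
rewrite -(ler_pM2r n0') -!mulrA (mulrC (r ^+ n)) [_ ^+ k * _]mulrA -exprSr.
apply: (@le_trans _ _ (`|C| * B)); last by rewrite [leRHS]mulrC.
rewrite (le_trans (ler_norm _))// normrM ler_wpM2l//.
by rewrite ger0_norm// mulr_ge0// exprn_ge0.
Qed.

(** The frequencies of a symmetric partial sum, listed so that an induction on [n] adds a frequency
    and its opposite together. *)
Fixpoint sym_range (n : nat) : seq int :=
  if n is m.+1 then n%:Z :: - n%:Z :: sym_range m else [:: 0].

Lemma mem_sym_range n (m : int) : (m \in sym_range n) = (`|m| <= n)%N.
Proof.
elim: n => [|n IH]; first by rewrite inE; lia.
by rewrite /= !inE IH; lia.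
Qed.

Lemma uniq_sym_range n : uniq (sym_range n).
Proof.
elim: n => [//|n IH] /=.
rewrite IH andbT inE !mem_sym_range; lia.
Qed.

(** * The Poisson kernel in polar coordinates *)

Lemma polar_lt1 (R : realType) (r t : R) : 0 <= r < 1 ->
  normc ((r * cos t) +i* (r * sin t))%C < 1.
Proof.
move=> /andP[r0 r1] /=.
rewrite !exprMn -mulrDr cos2Dsin2 mulr1 sqrtr_sqr ger0_norm//.
Qed.

Definition polar (R : realType) (r : R) (r01 : 0 <= r < 1) (t : R) : disc R :=
  Disc (polar_lt1 R r t r01).

Lemma normc_polar (R : realType) (r : R) (r01 : 0 <= r < 1) (t : R) :
  normc (polar R r r01 t : R[i]) = r.
Proof.
have /andP[r0 _] := r01.
by rewrite /= !exprMn -mulrDr cos2Dsin2 mulr1 sqrtr_sqr ger0_norm.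
Qed.

Lemma poisson_kernelE (R : realType) (r : R) (r01 : 0 <= r < 1) (t s : R) :
  poisson_kernel (polar R r r01 t) s =
  ((1 - r ^+ 2) * inv_poisson R r (s - t))%:C%C.
Proof.
rewrite /= -/(normc (polar R r r01 t : R[i])).
rewrite !exprMn -mulrDr cos2Dsin2 mulr1 !sqr_sqrtr ?sqr_ge0 ?addr_ge0 ?sqr_ge0//.
congr ((_ / _)%:C)%C.
have := cos2Dsin2 s; have := cos2Dsin2 t; rewrite cosB => h1 h2.
transitivity ((cos s ^+ 2 + sin s ^+ 2) + r ^+ 2 * (cos t ^+ 2 + sin t ^+ 2) - 2 * r * (cos s * cos t + sin s * sin t)); first by ring.
by rewrite h1 h2; ring.
Qed.

(* The right-hand side without the remainder is the value at [x] of the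
   partial sum of order [n] of the Poisson kernel. *)
Lemma poisson_partial_sum (R : realType) (r x : R) (n : nat) : 0 <= r < 1 ->
  (1 - r ^+ 2) * inv_poisson R r x =
  \sum_(m <- sym_range n) r ^+ `|m|%N * cos (m%:~R * x) +
  (2 * r ^+ n.+1 * (cos (n.+1%:R * x) * inv_poisson R r x) +
   - (2 * r ^+ n.+2) * (cos (n%:R * x) * inv_poisson R r x)).
Proof.
move=> r01; have := poisson_denom_gt0 R r x r01; rewrite /inv_poisson.
elim: n => [|n IH] D0.
  rewrite big_seq1 absz0 expr0 mulr0z !mul0r !mul1r cos0 expr1.
  by field; rewrite gt_eqF.
rewrite /= !big_cons IH//.
have -> : (- n.+1%:Z)%:~R * x = - (n.+1%:R * x) by rewrite mulrNz mulNr.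
rewrite cosN abszN absz_nat !pmulrn.
(* Centring the angles at (n+1)x reduces the step to cos((n+2)x) + cos(nx) = 2 cos x cos((n+1)x). *)
have -> : n.+2%:R * x = n.+1%:R * x + x :> R by rewrite -(natr1 n.+1); ring.
have -> : n%:R * x = n.+1%:R * x - x :> R by rewrite -(natr1 n); ring.
rewrite cosB cosD.
set a := cos _; set b := sin _.
by rewrite !exprS; field; rewrite gt_eqF.
Qed.

(** * Convergence of Fourier series inside the disc *)

Lemma tf_val_sum (R : realType) (I : Type) (l : seq I) (F : I -> testfun R) (s : R) :
  (\sum_(i <- l) F i) s = \sum_(i <- l) F i s.
Proof. by apply: (big_morph (fun phi : testfun R => phi s)). Qed.

Lemma expiD (R : realType) (s t : R) : expi (s + t) = expi s * expi t.
Proof. by rewrite /expi cosD sinD; congr (_ +i* _)%C; rewrite addrC mulrC [X in _ + X]mulrC. Qed.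

Lemma seminorm_real_le (R : realType) k (phi : testfun R) (g : R -> R) (B : R) :
  (forall t, phi t = (g t)%:C%C) -> (forall t, `|derive1n k g t| <= B) ->
  seminorm k phi <= B.
Proof.
move=> phig gB; apply: ge_sup; first by exists (normc (cderiven k phi 0)), 0.
move=> _ [t _ <-]; rewrite /cderiven.
rewrite (_ : (fun s => complex.Re (phi s)) = g); last first.
  by apply/funext => s; rewrite phig.
rewrite (_ : (fun s => complex.Im (phi s)) = cst 0); last first.
  by apply/funext => s; rewrite phig.
rewrite (_ : derive1n k (cst 0) t = 0) /=.
  by rewrite expr0n addr0 sqrtr_sqr.
elim: k t {gB} => [//|k IH] t; rewrite derive1nS (_ : derive1n k _ = cst 0).
  exact: derive1_cst.
by apply/funext.
Qed.

Section PartialSums.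
Context {R : realType} (f : circle_dist R) (r : R) (r01 : 0 <= r < 1).

(** The exponent is negative because [fourier_coef] pairs [f] with e^(imt) rather than with its
    conjugate. *)
Definition fourier_psum (t : R) (n : nat) : R[i] :=
  \sum_(m <- sym_range n)
    (r ^+ `|m|%N)%:C%C * expi (- (m%:~R * t)) * fourier_coef f m.

(** The test function whose pairing with [f] is [fourier_psum]. *)
Let kernel_psum (t : R) (n : nat) : testfun R :=
  \sum_(m <- sym_range n)
    ((r ^+ `|m|%N)%:C%C * expi (- (m%:~R * t))) *: expi_int R m.

Let remainder n x : R :=
  2 * r ^+ n.+1 * (cos (n.+1%:R * x) * inv_poisson R r x) +
  - (2 * r ^+ n.+2) * (cos (n%:R * x) * inv_poisson R r x).

Let kernel_psumE t n s :
  kernel_psum t n s =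
  (\sum_(m <- sym_range n) r ^+ `|m|%N * cos (m%:~R * (s - t)))%:C%C.
Proof.
rewrite /kernel_psum tf_val_sum.
transitivity (\sum_(m <- sym_range n) (r ^+ `|m|%N)%:C%C * expi (m%:~R * (s - t))).
  apply: eq_bigr => m _; rewrite -[LHS]/(_ * expi _) -mulrA -expiD.
  by congr (_ * expi _); ring.
(* Opposite frequencies enter together, so the imaginary parts cancel. *)
elim: n => [|n IH].
  by rewrite !big_seq1 /expi mul0r sin0 cos0 mulr1; exact: mulr1.
rewrite /= !big_cons IH -/(sym_range n).
rewrite mulrNz abszN absz_nat mulNr.
rewrite /expi cosN sinN.
set S := \sum_(_ <- _) _.

by apply/eqP; rewrite eq_complex /=; apply/andP; split; apply/eqP;  ring.
Qed.

Let remainderE t n s :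
  (poisson_kernel (polar R r r01 t) - kernel_psum t n) s = (remainder n (s - t))%:C%C.
Proof.
rewrite -[LHS]/(poisson_kernel (polar R r r01 t) s - kernel_psum t n s).
rewrite poisson_kernelE (poisson_partial_sum _ _ _ n)// kernel_psumE.
by rewrite -raddfB /= /remainder addrAC subrr add0r.
Qed.

Let derive1n_remainder_le k : exists C : R, forall n t,
  `|derive1n k (remainder n) t| <= C * n.+1%:R ^+ k * r ^+ n.
Proof.
have /andP[r0 r1] := r01.
have [C HC] := derive1n_modulated_le r r01 (inv_poisson R r) k (pa_inv R r).
(* The term of frequency [n.+1] brings (n+2)^k, which is at most 2^k (n+1)^k; this explains the
   first constant. The term of frequency [n] gives the second. *)
exists (2 ^+ k.+1 * C + 2 * C) => n t.
have eq_le (x y : R) : x = y -> x <= y by move=> ->.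
have C0 : 0 <= C.
  have [+ _] := HC 0%N 0; rewrite expr1n mulr1; exact: le_trans.
have sm m : smooth (fun x => cos (m%:R * x) * inv_poisson R r x).
  apply: elementary_smooth; apply: elem_mul; first exact: elem_cos.
  exact/(poisson_algebra_elementary _ r01)/pa_inv.
have -> : (2 ^+ k.+1 * C + 2 * C) * n.+1%:R ^+ k * r ^+ n =
    2 ^+ k.+1 * C * n.+1%:R ^+ k * r ^+ n + 2 * C * n.+1%:R ^+ k * r ^+ n.
  by ring.
rewrite derive1n_lin// (le_trans (ler_normD _ _))// lerD//.
- rewrite normrM ger0_norm ?mulr_ge0 ?exprn_ge0//.
  have [+ _] := HC n.+1 t => H1.
  apply: (@le_trans _ _ (2 * r ^+ n * (C * (2 * n.+1%:R) ^+ k))).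
    rewrite ler_pM// ?mulr_ge0 ?exprn_ge0//.
      by rewrite ler_wpM2l// exprS ler_piMl ?exprn_ge0// ltW.
    rewrite (le_trans H1)// ler_wpM2l// lerXn2r ?nnegrE//.
    by rewrite -natrM ler_nat; lia.
  by rewrite exprMn exprS; apply: eq_le; ring.
- rewrite normrM normrN (@ger0_norm _ (2 * r ^+ n.+2)); last first.
    by rewrite mulr_ge0// exprn_ge0.
  have [+ _] := HC n t => H1.
  apply: (@le_trans _ _ (2 * r ^+ n * (C * n.+1%:R ^+ k))).
    rewrite ler_pM//; first by rewrite mulr_ge0// exprn_ge0.
    rewrite ler_wpM2l// !exprS mulrA ler_piMl//; first exact: exprn_ge0.
    by rewrite mulr_ile1// ltW.
  by apply: eq_le; ring.
Qed.

(** Continuity of [f] bounds the error by finitely many seminorms of the remainder of the kernel,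
    each at most a power of [n.+1] times r^n. Uniformity in [t] holds because [t] only translates
    the remainder. The lower bound [n0] lets the partial sum contain any prescribed frequencies. *)
Lemma poisson_ext_approx (n0 : nat) (e : R) : 0 < e ->
  exists2 n, (n0 <= n)%N & forall t,
    normc (poisson_ext f (polar R r r01 t) - fourier_psum t n) <= e.
Proof.
move=> e0; have /andP[r0 r1] := r01.
have [N [K HK]] := pairing_continuous f.
have [C HC] : exists C : R, forall k, (k < N.+1)%N -> forall n t,
    `|derive1n k (remainder n) t| <= C * n.+1%:R ^+ N * r ^+ n.
  (* One constant for all orders up to [N] is built by adding the constants of the single orders. *)
  suff : forall N', exists2 C : R, 0 <= C & forall k, (k < N')%N -> forall n t,
      `|derive1n k (remainder n) t| <= C * n.+1%:R ^+ k * r ^+ n.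
    move=> /(_ N.+1)[C C0 H]; exists C => k kN n t.
    rewrite (le_trans (H _ kN _ _))// ler_wpM2r ?exprn_ge0// ler_wpM2l//.
    by rewrite ler_weXn2l// ler1n.
  elim=> [|N' [C C0 IH]]; first by exists 0.
  have [D HD] := derive1n_remainder_le N'.
  exists (C + `|D|) => [|k kN n t]; first exact: addr_ge0.
  rewrite !mulrDl; move: kN; rewrite ltnS leq_eqVlt => /orP[/eqP ->|kN'].
    rewrite (le_trans (HD _ _))// ler_wpDl ?mulr_ge0 ?exprn_ge0//.
    by rewrite !ler_wpM2r ?exprn_ge0// ler_norm.
  by rewrite (le_trans (IH _ kN' _ _))// ler_wpDr// ?mulr_ge0 ?exprn_ge0.
have [n nn0 nC] := natr_exp_geometric _ _ (`|K| * N.+1%:R * C) e N n0 r01 e0.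
exists n => // t.
have -> : poisson_ext f (polar R r r01 t) - fourier_psum t n =
    f (poisson_kernel (polar R r r01 t) - kernel_psum t n).
  rewrite raddfB; congr (_ - _).
  rewrite raddf_sum; apply: eq_bigr => m _; exact/esym/linearZ.
apply: (le_trans (HK _)); apply: le_trans nC.
set T := _ - _ : testfun R.
have Tk k : (k < N.+1)%N -> seminorm k T <= C * n.+1%:R ^+ N * r ^+ n.
  move=> kN; apply: seminorm_real_le; first by move=> s; exact: remainderE.
  by move=> s; rewrite derive1n_shift; exact: HC.
(* Replacing [K] by its absolute value requires a nonnegative sum; a set without supremum has [sup]
   equal to 0. *)
have S0 : 0 <= \sum_(k < N.+1) seminorm k T.
  apply: sumr_ge0 => k _; rewrite /seminorm.
  set S := (X in sup X); have [hS|/sup_out ->//] := pselect (has_sup S).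
  apply: (@le_trans _ _ (normc (cderiven k T 0))); first by rewrite /= sqrtr_ge0.
  by apply: sup_upper_bound => //; exists 0.
apply: (@le_trans _ _ (`|K| * \sum_(k < N.+1) seminorm k T)).
  by rewrite ler_wpM2r// ler_norm.
rewrite -!mulrA ler_wpM2l//.
apply: (@le_trans _ _ (\sum_(k < N.+1) (C * n.+1%:R ^+ N * r ^+ n))).
  by apply: ler_sum => k _; exact: Tk.
by rewrite sumr_const card_ord -[leLHS]mulr_natl !mulrA.
Qed.

End PartialSums.

(** * Parseval's identity *)

(** The integral over a period, witnessed by an antiderivative: linearity becomes algebra, and the
    fundamental theorem of calculus is applied only once, in [parseval_trig]. *)
Definition circle_integral (R : realType) (g : R -> R) (v : R) : Prop :=
  exists2 G : R -> R, (forall x : R, is_derive x 1 G (g x)) & G (pi *+ 2) - G 0 = v.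

Lemma circle_integral_eq (R : realType) (g h : R -> R) (v w : R) :
  g =1 h -> v = w -> circle_integral R g v -> circle_integral R h w.
Proof. by move=> /funext -> ->. Qed.

Lemma circle_integral_sum (R : realType) (I : Type) (l : seq I)
    (g : I -> R -> R) (v : I -> R) :
  (forall i, circle_integral R (g i) (v i)) ->
  circle_integral R (fun t => \sum_(i <- l) g i t) (\sum_(i <- l) v i).
Proof.
move=> H; elim: l => [|i l [G dG vG]].
  exists (cst 0); last by rewrite big_nil subrr.
  by move=> x; rewrite big_nil; exact: is_derive_cst.
have [F dF vF] := H i; exists (F \+ G) => [x|].
  by rewrite big_cons; exact: is_deriveD.
by rewrite big_cons -vF -vG /=; ring.
Qed.

Lemma cos_int2pi (R : realType) (n : int) : cos (n%:~R * (pi *+ 2)) = 1 :> R.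
Proof.
have key (m : nat) : cos (m%:R * (pi *+ 2)) = 1 :> R.
  by rewrite mulr_natl -[X in cos X]add0r (periodicn (@cosD2pi R)) cos0.
case: n => m; first exact: key.
by rewrite NegzE mulrNz mulNr cosN; exact: key.
Qed.

Lemma sin_int2pi (R : realType) (n : int) : sin (n%:~R * (pi *+ 2)) = 0 :> R.
Proof.
have key (m : nat) : sin (m%:R * (pi *+ 2)) = 0 :> R.
  by rewrite mulr_natl -[X in sin X]add0r (periodicn (@sinD2pi R)) sin0.
case: n => m; first exact: key.
by rewrite NegzE mulrNz mulNr sinN [X in - X]key oppr0.
Qed.

Lemma circle_integral_expi (R : realType) (w : R[i]) (n : int) :
  circle_integral R (fun t => complex.Re (w * expi (n%:~R * t)))
    (if n == 0 then pi *+ 2 * complex.Re w else 0).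
Proof.
case: w => a b /=; have [->|n0] := eqVneq n 0.
  exists (fun x => a * x) => [x|]; last by ring.
  rewrite mulr0z mul0r cos0 sin0.
  have := is_deriveZ a (is_derive_id x (1 : R)).
  by rewrite /GRing.scale/= mulr0 subr0.
have n0R : n%:~R != 0 :> R by rewrite intr_eq0.
exists (fun x => a / n%:~R * sin (n%:~R * x) + b / n%:~R * cos (n%:~R * x)) => [x|].
  have H := is_deriveD (is_deriveZ (a / n%:~R) (is_derive_sin_lin n%:~R x))
                       (is_deriveZ (b / n%:~R) (is_derive_cos_lin n%:~R x)).
  by apply: (is_derive_eq H); rewrite /GRing.scale/=; field.
by rewrite cos_int2pi sin_int2pi !mulr0 sin0 cos0; ring.
Qed.

Lemma sqr_normc (R : rcfType) (z : R[i]) :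
  normc z ^+ 2 = complex.Re (z * z^*%C).
Proof.
by case: z => a b /=; rewrite sqr_sqrtr ?addr_ge0 ?sqr_ge0//; ring.
Qed.

Lemma Re_sum (R : rcfType) (I : Type) (l : seq I) (F : I -> R[i]) :
  complex.Re (\sum_(i <- l) F i) = \sum_(i <- l) complex.Re (F i).
Proof. by apply: (big_morph (@complex.Re R)) => // -[? ?] []. Qed.

Lemma circle_integral_parseval (R : realType) (l : seq int) (d : int -> R[i]) :
  uniq l ->
  circle_integral R
    (fun t => normc (\sum_(m <- l) d m * expi (- (m%:~R * t))) ^+ 2)
    (pi *+ 2 * \sum_(m <- l) normc (d m) ^+ 2).
Proof.
move=> ul.
(* The squared modulus is expanded into a double sum of terms with frequency k - m; only the
   diagonal has a nonzero integral. *)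
have H := circle_integral_sum R _ l _ _ (fun m => circle_integral_sum R _ l _ _
  (fun k => circle_integral_expi R (d m * (d k)^*%C) (k - m))).
apply: circle_integral_eq H => [t|].
- rewrite sqr_normc rmorph_sum /= mulr_suml Re_sum; apply: eq_bigr => m _.
  rewrite mulr_sumr Re_sum; apply: eq_bigr => k _; congr complex.Re.
  have -> : (d k * expi (- (k%:~R * t)))^*%C = (d k)^*%C * expi (k%:~R * t).
    by rewrite rmorphM; congr (_ * _); rewrite /expi /= cosN sinN opprK.
  rewrite mulrACA -expiD; congr (_ * expi _).
  by rewrite rmorphB /=; ring.
- rewrite mulr_sumr !big_seq; apply: eq_bigr => m ml.
  rewrite (bigD1_seq m)//= subrr eqxx big1 ?addr0 ?sqr_normc// => k km.
  by rewrite subr_eq0 (negbTE km).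
Qed.

Lemma continuous_normc_psum_sqr (R : realType) (l : seq int) (d : int -> R[i]) :
  continuous (fun t : R => normc (\sum_(m <- l) d m * expi (- (m%:~R * t))) ^+ 2).
Proof.
have lin (m : int) : continuous (fun t : R => - (m%:~R * t)).
  by move=> t; apply: cvgN; apply: cvgZr; exact: cvg_id.
have ce m : continuous (fun t : R => complex.Re (d m * expi (- (m%:~R * t)))) /\
            continuous (fun t : R => complex.Im (d m * expi (- (m%:~R * t)))).
  case: (d m) => a b /=; split=> t.
  - by apply: cvgB; apply: cvgZr; apply: continuous_comp; try exact: lin;
      (exact: continuous_cos || exact: continuous_sin).
  - by apply: cvgD; apply: cvgZr; apply: continuous_comp; try exact: lin;
      (exact: continuous_cos || exact: continuous_sin).
suff [cR cI] : continuous (fun t : R => complex.Re (\sum_(m <- l) d m * expi (- (m%:~R * t)))) /\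
        continuous (fun t : R => complex.Im (\sum_(m <- l) d m * expi (- (m%:~R * t)))).
  rewrite (_ : (fun t => _) = fun t => complex.Re (\sum_(m <- l) d m * expi (- (m%:~R * t))) *
    complex.Re (\sum_(m <- l) d m * expi (- (m%:~R * t))) +
    complex.Im (\sum_(m <- l) d m * expi (- (m%:~R * t))) *
    complex.Im (\sum_(m <- l) d m * expi (- (m%:~R * t)))).
    move=> t; exact: (continuousD (continuousM (cR t) (cR t)) (continuousM (cI t) (cI t))).
  apply/funext => t; case: (\sum_(m <- l) _) => a b /=.
  by rewrite sqr_sqrtr ?addr_ge0 ?sqr_ge0// !expr2.
elim: l => [|m l [IHR IHI]].
  by split; under eq_fun do rewrite big_nil; move=> t; exact: cvg_cst.
have [ceR ceI] := ce m.
split.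
- have -> : (fun t : R => complex.Re (\sum_(i <- m :: l) d i * expi (- (i%:~R * t)))) =
      (fun t : R => complex.Re (d m * expi (- (m%:~R * t))) +
        complex.Re (\sum_(i <- l) d i * expi (- (i%:~R * t)))).
    apply/funext => t; rewrite big_cons.
    by case: (d m * _) (\sum_(_ <- _) _) => ? ? [].
  by move=> t; exact: (continuousD (ceR t) (IHR t)).
- have -> : (fun t : R => complex.Im (\sum_(i <- m :: l) d i * expi (- (i%:~R * t)))) =
      (fun t : R => complex.Im (d m * expi (- (m%:~R * t))) +
        complex.Im (\sum_(i <- l) d i * expi (- (i%:~R * t)))).
    apply/funext => t; rewrite big_cons.
    by case: (d m * _) (\sum_(_ <- _) _) => ? ? [].
  by move=> t; exact: (continuousD (ceI t) (IHI t)).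
Qed.

Lemma parseval_trig (R : realType) (l : seq int) (d : int -> R[i]) : uniq l ->
  (\int[@lebesgue_measure R]_(t in `[0%R, (pi *+ 2)%R])
     (normc (\sum_(m <- l) d m * expi (- (m%:~R * t))) ^+ 2)%:E =
  (pi *+ 2 * \sum_(m <- l) normc (d m) ^+ 2)%:E)%E.
Proof.
move=> /(circle_integral_parseval R l d)[G dG <-].
have pi2 : 0 < pi *+ 2 :> R by rewrite mulrn_wgt0// pi_gt0.
have dG' x : derivable G x 1 by have [] := dG x.
have cG : continuous G by move=> x; exact/differentiable_continuous/derivable1_diffP.
rewrite EFinB; apply: continuous_FTC2 => //.
- exact/continuous_subspaceT/continuous_normc_psum_sqr.
- split=> //.
  + by apply: cvg_at_right_filter; exact: cG.
  + by apply: cvg_at_left_filter; exact: cG.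
- by move=> x _; rewrite derive1E; exact: derive_val.
Qed.

(** * The nontangential maximal function *)

Lemma sin_le_abs (R : realType) (x : R) : `|sin x| <= `|x|.
Proof.
wlog x0 : x / 0 < x.
  move=> H; have [x0|x0|->] := ltrgt0P x; last by rewrite sin0 normr0.
  - by have := H _ x0; rewrite (gtr0_norm x0).
  - have := H (- x); rewrite sinN !normrN oppr_gt0 => /(_ x0).
    by rewrite (ltr0_norm x0).
have [|c _] := @MVT _ sin cos 0 x x0 (fun y _ => is_derive_sin y).
  by apply: continuous_subspaceT => y; exact: continuous_sin.
rewrite sin0 !subr0 => ->; rewrite normrM ler_piMl//.
by rewrite ler_norml cos_le1 cos_geN1.
Qed.

(** The chord has length 2 |sin((s - t)/2)|. *)
Lemma normc_expiB (R : realType) (s t : R) : normc (expi s - expi t) <= `|s - t|.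
Proof.
rewrite -(ler_pXn2r (n := 2))// ?nnegrE//; last by rewrite /= sqrtr_ge0.
rewrite real_normK ?num_real//= sqr_sqrtr ?addr_ge0 ?sqr_ge0//.
have -> : (cos s - cos t) ^+ 2 + (sin s - sin t) ^+ 2 =
    4 * sin ((s - t) / 2) ^+ 2.
  have h1 := cos2Dsin2 s; have h2 := cos2Dsin2 t.
  have h3 := cos2Dsin2 ((s - t) / 2).
  have : cos (s - t) = cos ((s - t) / 2) ^+ 2 *+ 2 - 1.
    by rewrite -cos_mulr2n; congr cos; rewrite mulr2n -splitr.
  rewrite cosB => h4; move: h1 h2 h3 h4; set c := cos (_ / 2).
  set d := sin (_ / 2); rewrite mulr2n; nra.
have : sin ((s - t) / 2) ^+ 2 <= ((s - t) / 2) ^+ 2.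
  rewrite -[leLHS]real_normK ?num_real// -[leRHS]real_normK ?num_real//.
  by rewrite lerXn2r ?nnegrE// sin_le_abs.
rewrite expr_div_n; set a := sin _ ^+ 2; set b := (s - t) ^+ 2; lra.
Qed.

Lemma normc_ge0 (R : rcfType) (z : R[i]) : 0 <= normc z.
Proof. by case: z => a b /=; exact: sqrtr_ge0. Qed.

Section NontangentialMaximal.
Context {R : realType} (alpha : R) (alpha_gt1 : 1 < alpha) (f : circle_dist R).

(** Going from the vertex e^(it) to r e^(is) through e^(is) costs at most |t - s| + (1 - r). *)
Lemma polar_stolz (r : R) (r01 : 0 <= r < 1) (s t : R) :
  `|t - s| < (alpha - 1) * (1 - r) -> stolz alpha t (polar R r r01 s).
Proof.
move=> ts; rewrite /stolz.
change (normc (expi t - (polar R r r01 s : R[i])) <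
  alpha * (1 - normc (polar R r r01 s : R[i]))).
rewrite normc_polar.
have /andP[r0 r1] := r01.
apply: (@le_lt_trans _ _ (`|t - s| + (1 - r))); last by nra.
have -> : expi t - (polar R r r01 s : R[i]) =
    (expi t - expi s) + (1 - r)%:C%C * expi s.
  by apply/eqP; rewrite eq_complex /=; apply/andP; split; apply/eqP; ring.
apply: (le_trans (le_normcD _ _)); rewrite lerD ?normc_expiB// normcM /=.
by rewrite cos2Dsin2 sqrtr1 mulr1 expr0n addr0 sqrtr_sqr ger0_norm// subr_ge0 ltW.
Qed.

Lemma poisson_ext_le_nt_max (r : R) (r01 : 0 <= r < 1) (s t : R) :
  `|t - s| < (alpha - 1) * (1 - r) ->
  ((normc (poisson_ext f (polar R r r01 s)))%:E <= nt_max alpha f t)%E.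
Proof.
move=> ts; apply: ereal_sup_ubound => /=.
by exists (polar R r r01 s) => //; exact: polar_stolz.
Qed.

(** As [alpha] exceeds 1, every region contains the centre of the disc, so the supremum is not that
    of the empty set, which would be -oo. *)
Lemma nt_max_ge0 (t : R) : (0 <= nt_max alpha f t)%E.
Proof.
have r01 : 0 <= (0 : R) < 1 by rewrite lexx ltr01.
have := @poisson_ext_le_nt_max 0 r01 t t.
rewrite subrr normr0 subr0 mulr1 subr_gt0 => /(_ alpha_gt1).
by apply: le_trans; rewrite lee_fin normc_ge0.
Qed.

(** A point of the region with vertex e^(it) satisfies a strict inequality, so it stays in the
    region when the vertex moves by less than the slack [e]. *)
Lemma lower_semicontinuous_nt_max : lower_semicontinuous (nt_max alpha f).
Proof.
move=> t a /ereal_sup_gt[_ [z zt <-] az].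
pose e := alpha * (1 - normc (z : R[i])) - normc (expi t - (z : R[i])).
have e0 : 0 < e by rewrite subr_gt0.
exists (ball t e); first exact: nbhsx_ballx.
move=> s; rewrite /ball /= => ts.
apply: (lt_le_trans az); apply: ereal_sup_ubound; exists z => //.
rewrite /stolz /=.
have -> : expi s - (z : R[i]) = (expi s - expi t) + (expi t - (z : R[i])) by ring.
apply: (le_lt_trans (le_normcD _ _)).
have := normc_expiB R s t; rewrite distrC; move: ts; rewrite /e; lra.
Qed.

Lemma measurable_nt_max : measurable_fun [set: R] (nt_max alpha f : R -> \bar R).
Proof.
apply: lower_semicontinuous_measurable; exact: lower_semicontinuous_nt_max.
Qed.

End NontangentialMaximal.

(** * The function Psi0 *)

Section Psi0Theory.
Context {R : realType}.
Implicit Types s t y : R.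

Let e0 : 0 < expR (1 : R). Proof. exact: expR_gt0. Qed.

Lemma ln_e_addr_ge1 t : 0 <= t -> 1 <= ln (expR 1 + t).
Proof.
move=> t0; rewrite -[leLHS](expRK 1) ler_ln ?posrE ?lerDl//. have := e0; lra.
Qed.

Let ln_gt0' t : 0 <= t -> 0 < ln (expR 1 + t).
Proof. by move=> /ln_e_addr_ge1; exact: lt_le_trans. Qed.

Lemma Psi0_ge0 t : 0 <= t -> 0 <= Psi0 t.
Proof. by move=> t0; rewrite /Psi0 divr_ge0// ltW// ln_gt0'. Qed.

Lemma Psi0_le_id t : 0 <= t -> Psi0 t <= t.
Proof.
by move=> t0; rewrite /Psi0 ler_pdivrMr ?ln_gt0'// ler_peMr// ln_e_addr_ge1.
Qed.

(** From [s] to [t] the logarithm grows by at most (t - s)/(e + s). Times [s] this is at most t - s,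
    hence at most (t - s) log(e + s). *)
Lemma Psi0_homo s t : 0 <= s -> s <= t -> Psi0 s <= Psi0 t.
Proof.
move=> s0 st; have e0' := e0; have t0 := le_trans s0 st.
rewrite /Psi0 ler_pdivrMr ?ln_gt0'// mulrAC ler_pdivlMr ?ln_gt0'//.
have es : 0 < expR 1 + s by lra.
have -> : expR 1 + t = (expR 1 + s) * (1 + (t - s) / (expR 1 + s)).
  by field; rewrite gt_eqF.
have q0 : 0 <= (t - s) / (expR 1 + s) by rewrite divr_ge0 ?subr_ge0// ltW.
rewrite lnM ?posrE//; last by rewrite ltr_pwDl.
have : ln (1 + (t - s) / (expR 1 + s)) <= (t - s) / (expR 1 + s).
  by apply: le_ln1Dx; apply: lt_le_trans q0; rewrite ltrN10.
have : s * ((t - s) / (expR 1 + s)) <= t - s.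
  by rewrite mulrA ler_pdivrMr// mulrC ler_wpM2l ?subr_ge0//; lra.
have := ln_e_addr_ge1 s s0.
set a := ln _; set b := ln _; set c := _ / _; nra.
Qed.

(** Psi0(t)/t decreases; the product form also covers y = 0. *)
Lemma Psi0_ratio y t : 0 <= y -> y <= t -> Psi0 t * y <= Psi0 y * t.
Proof.
move=> y0 yt; have e0' := e0; have t0 := le_trans y0 yt.
rewrite /Psi0 mulrAC [leRHS]mulrAC (mulrC y t) ler_wpM2l ?mulr_ge0//.
rewrite lef_pV2 ?posrE ?ln_gt0'// ler_ln ?posrE ?lerD2l//; lra.
Qed.

(** Doubling [t] adds at most log 2 to a logarithm that is at least 1, so Psi0(2t)/Psi0(t) is at
    least 2/(1 + log 2), the inverse of [rho]. *)
Let rho : R := (1 + ln 2) / 2.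

Let rho01 : 0 < rho < 1.
Proof.
have l2 : 0 < ln 2 :> R by apply: ln_gt0; lra.
have : ln 2 < 1 :> R.
  rewrite -[ltRHS](expRK 1) ltr_ln ?posrE ?expR_gt0//.
  have := @expR_gt1Dx R 1; rewrite oner_neq0 => /(_ isT); lra.
rewrite /rho; lra.
Qed.

Let Psi0_double t : 0 <= t -> Psi0 t <= rho * Psi0 (2 * t).
Proof.
move=> t0; have e0' := e0; rewrite /Psi0 ler_pdivrMr ?ln_gt0'// mulrAC mulrA ler_pdivlMr; last first.
  by rewrite ln_gt0'// mulr_ge0.
have H : ln (expR 1 + 2 * t) <= ln 2 + ln (expR 1 + t).
  by rewrite -lnM ?posrE//; [rewrite ler_ln ?posrE//; lra|lra].
have := ln_e_addr_ge1 t t0; have l2 : 0 < ln 2 :> R by apply: ln_gt0; lra.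
move: H l2; rewrite /rho; set a := ln _; set b := ln _; set c := ln _ => H l2 H1.
have : a <= (1 + b) * c by nra.
move=> H2.
by apply: (le_trans (ler_wpM2l t0 H2)); rewrite le_eqVlt; apply/orP; left; apply/eqP; field.
Qed.

Lemma Psi0_double_le t : 0 <= t -> Psi0 (2 * t) <= 2 * Psi0 t.
Proof.
move=> t0; have e0' := e0; rewrite /Psi0 mulrA ler_pdivrMr; last by rewrite ln_gt0'// mulr_ge0.
rewrite -[leLHS]mulr1 -!mulrA ler_wpM2l// ler_wpM2l//.
rewrite ler_pdivlMl ?ln_gt0'// mulr1 ler_ln ?posrE//; lra.
Qed.

(* Below [y] the summands grow geometrically; above [y] they decay geometrically. *)
Lemma Psi0_dyadic_sum : exists2 C : R, 0 < C & forall y l0 n, 0 <= y -> 0 < l0 ->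
  \sum_(j < n) Psi0 (2 ^+ j.+1 * l0) * (Num.min y (2 ^+ j * l0) / (2 ^+ j * l0)) ^+ 2
    <= C * Psi0 y.
Proof.
have /andP[r0 r1] := rho01.
(* The solution of (K + 1) rho = K: if the sum below level [l n] is at most K Psi0(l n), one more
   term keeps it at most K Psi0(l n.+1). *)
pose K := rho / (1 - rho).
have K0 : 0 < K by rewrite divr_gt0// subr_gt0.
have Keq : (K + 1) * rho = K by rewrite /K; field; lra.
exists (2 * (K + 3)) => [|y l0 n y0 l00]; first by lra.
pose l j := 2 ^+ j * l0.
have lpos j : 0 < l j by rewrite mulr_gt0// exprn_gt0.
have lS j : l j.+1 = 2 * l j by rewrite /l exprS mulrA.
pose T j := Psi0 (l j) * (Num.min y (l j) / l j) ^+ 2.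
have P0 := Psi0_ge0 y y0.
have T1 j : l j <= y -> T j = Psi0 (l j).
  by move=> ly; rewrite /T min_r// divff ?gt_eqF// expr1n mulr1.
have T2 j : y < l j -> T j <= Psi0 y * (y / l j).
  move=> yl; rewrite /T (min_l (ltW yl)) expr2 (mulrA (Psi0 (l j))) ler_wpM2r//.
    by rewrite divr_ge0// ltW.
  by rewrite mulrA ler_pdivrMr// Psi0_ratio// ltW.
(* Invariant for the induction. When the levels cross [y], the bracket is at least 1 and pays for
   the crossing term. Afterwards each step enlarges it by y / l n, exactly the bound [T2] on the new
   term. *)
suff [H1 H2] : (l n <= y -> \sum_(j < n) T j <= K * Psi0 (l n)) /\
    (y < l n -> \sum_(j < n) T j <= K * Psi0 y + Psi0 y * (3 - 2 * (y / l n))).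
  apply: (@le_trans _ _ (2 * \sum_(j < n) T j)).
    rewrite mulr_sumr ler_sum// => j _; rewrite /T mulrA ler_wpM2r ?sqr_ge0//.
    by rewrite -[2 ^+ _ * l0]/(l j.+1) lS Psi0_double_le// ltW.
  rewrite -mulrA ler_wpM2l//; have [ly|ly] := leP (l n) y.
    apply: (le_trans (H1 ly)).
    have := Psi0_homo _ _ (ltW (lpos n)) ly; nra.
  apply: (le_trans (H2 ly)).
  have : 0 <= y / l n by rewrite divr_ge0// ltW.
  nra.
elim: n => [|n [IH1 IH2]].
  rewrite big_ord0; split=> ly; first by rewrite mulr_ge0 ?Psi0_ge0// ltW.
  have : y / l 0%N <= 1 by rewrite ler_pdivrMr// mul1r ltW.
  have := mulr_ge0 (ltW K0) P0; nra.
rewrite !big_ord_recr /=; split=> ly.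
  have ly' : l n <= y by move: ly; rewrite lS; have := lpos n; lra.
  rewrite T1// lS.
  have := IH1 ly'; have := Psi0_double (l n) (ltW (lpos n)).
  have := Psi0_ge0 _ (ltW (lpos n)); nra.
have [ly'|ly'] := leP (l n) y.
  rewrite T1//.
  have : y / l n.+1 <= 1 by rewrite ler_pdivrMr// mul1r ltW.
  have := IH1 ly'; have := Psi0_homo _ _ (ltW (lpos n)) ly'; nra.
have -> : y / l n.+1 = y / l n / 2 by rewrite lS; field; rewrite gt_eqF.
have := IH2 ly'; have := T2 _ ly'; lra.
Qed.

Lemma measurable_er_map_Psi0 (g : R -> \bar R) : measurable_fun [set: R] g ->
  (forall t, 0 <= g t)%E ->
  measurable_fun [set: R] (fun t => er_map (@Psi0 R) (g t)).
Proof.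
move=> mg g0.
(* On nonnegative arguments the inverse of the logarithm is its real power of exponent -1. *)
rewrite (_ : (fun t => _) =
    er_map (fun t => t * (ln (expR 1 + t) `^ (-1))) \o g); last first.
  apply/funext => t /=; have := g0 t; case: (g t) => //= x; rewrite lee_fin => x0.
  by rewrite /Psi0 powR_inv1// ltW// ln_gt0'.
apply: measurableT_comp => //.
apply: (@measurable_er_map _ (measurableTypeR R)).
apply: measurable_funM; first exact: measurable_id.
apply: (measurableT_comp (@measurable_powR R (-1))).
apply: (measurableT_comp (@measurable_ln R)).
by apply: measurable_funD; [exact: measurable_cst|exact: measurable_id].
Qed.

End Psi0Theory.

(** * Sums over integer frequencies and truncation *)

Lemma ler_sum_uniq_sub (R : numDomainType) (I : eqType) (l l' : seq I) (P : pred I)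
    (F : I -> R) : uniq l -> uniq l' -> {subset l <= l'} ->
  {in l, forall i, P i} -> (forall i, P i -> 0 <= F i) ->
  \sum_(i <- l) F i <= \sum_(i <- l' | P i) F i.
Proof.
move=> ul ul' ll' lP F0.
rewrite (perm_big [seq i <- l' | i \in l]); last first.
  apply: uniq_perm => //; first exact: filter_uniq.
  by move=> i; rewrite mem_filter; case: (boolP (i \in l)) => //= /ll' ->.
rewrite big_filter !(big_mkcond _ F) /= ler_sum// => i _.
case: ifPn => [il|_]; first by rewrite lP.
by case: ifPn => // /F0.
Qed.

(** Frequencies k and -k together contribute 2/k^2, at most 4/k - 4/(k + 1) for k >= 1, and this
    telescopes. The maximum with [a] in the strengthened bound covers the ranges that do not yet
    reach [a]. *)
Lemma sum_inv_sqr_tail (R : realFieldType) (a : R) (n : nat) : 0 < a ->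
  \sum_(m <- sym_range n | (m != 0) && (a < `|m|%N%:R)) (m%:~R ^+ 2)^-1 <= 4 / a.
Proof.
move=> a0.
suff : \sum_(m <- sym_range n | (m != 0) && (a < `|m|%N%:R)) (m%:~R ^+ 2)^-1 <=
    4 / a - 4 / Num.max a n.+1%:R.
  move/le_trans; apply; rewrite lerBlDr lerDl divr_ge0// le_max ltW//.
elim: n => [|n IH].
  rewrite big_mkcond big_seq1 /= subr_ge0 ler_wpM2l// lef_pV2 ?posrE//.
    by rewrite le_max lexx.
  by rewrite lt_max a0.
rewrite /= !big_cons abszN absz_nat oppr_eq0 eqz_nat /=.
have n1 : 0 < n.+1%:R :> R by rewrite ltr0n.
have n2 : 0 < n.+2%:R :> R by rewrite ltr0n.
have n12 : n.+2%:R = n.+1%:R + 1 :> R by rewrite natr1.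
have n11 : 1 <= n.+1%:R :> R by rewrite ler1n.
case: ltP => [an|na].
- rewrite (max_r (ltW (lt_trans an _))) ?n12 ?ltrDl//.
  rewrite (max_r (ltW an)) in IH.
  rewrite rmorphN sqrrN /= -pmulrn.
  set S := (X in _ + (_ + X)).
  have {}IH : S <= 4 / a - 4 / n.+1%:R := IH.
  set k := n.+1%:R in n1 n11 IH *.
  have k0 : k != 0 by rewrite gt_eqF.
  have H : (k ^+ 2)^-1 + (k ^+ 2)^-1 <= 4 / k - 4 / (k + 1).
    rewrite -subr_ge0.
    have -> : 4 / k - 4 / (k + 1) - ((k ^+ 2)^-1 + (k ^+ 2)^-1) =
      2 * (k - 1) / (k ^+ 2 * (k + 1)) by field; rewrite gt_eqF//; lra.
    by apply: divr_ge0; apply: mulr_ge0 => //; rewrite ?sqr_ge0//; lra.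
  move: IH H; set x := (k ^+ 2)^-1; set y := 4 / a; set z := 4 / k; set w := 4 / _; lra.
- apply: (le_trans IH); rewrite lerB// ler_wpM2l//.
  rewrite lef_pV2 ?posrE ?lt_max ?a0//.
  by rewrite ge_max !le_max lexx /= orbC ler_nat leqnSn.
Qed.

Lemma normc_intrM (R : rcfType) (n : int) (z : R[i]) :
  normc (n%:~R * z) = `|n%:~R : R| * normc z.
Proof.
rewrite normcM; congr (_ * _).
have -> : n%:~R = (n%:~R : R)%:C%C by rewrite (rmorph_int (real_complex R)).
by rewrite /= expr0n addr0 sqrtr_sqr.
Qed.

Section Truncation.
Context {R : realType}.
Implicit Types (y : \bar R) (l x : R).

(** For nonnegative [y], even +oo, the minimum is finite, so [fine] loses nothing. *)
Definition etrunc l y : R := fine (mine y l%:E).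

Lemma etrunc_ge0 l y : 0 <= l -> (0 <= y)%E -> 0 <= etrunc l y.
Proof. by move=> l0 y0; rewrite /etrunc fine_ge0// le_min y0 lee_fin. Qed.

Lemma etrunc_le l y : (0 <= y)%E -> etrunc l y <= l.
Proof.
rewrite /etrunc; case: y => [x _|_|]//.
by rewrite -EFin_min /= ge_min lexx orbT.
Qed.

Lemma le_etrunc l x y : x <= l -> (0 <= y)%E -> (x%:E <= y)%E -> x <= etrunc l y.
Proof.
rewrite /etrunc; case: y => [z xl _|xl _ _|]//.
by rewrite lee_fin -EFin_min /= le_min => ->.
Qed.

Lemma etrunc_gt l y : (l%:E < y)%E -> etrunc l y = l.
Proof. by move=> ly; rewrite /etrunc min_r// ltW. Qed.

Lemma etrunc_fin l x : etrunc l x%:E = Num.min x l.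
Proof. by rewrite /etrunc -EFin_min. Qed.

Lemma measurable_etrunc l (g : R -> \bar R) :
  measurable_fun [set: R] g -> measurable_fun [set: R] (fun t => etrunc l (g t)).
Proof.
move=> mg; rewrite (_ : (fun t => _) = fine \o (fun t => mine (g t) l%:E))//.
apply: measurableT_comp; first exact: fine_measurable.
by apply: measurable_mine => //; exact: measurable_cst.
Qed.

End Truncation.

(** * Distribution of the Fourier coefficients *)

Section Bessel.
Context {R : realType}.
Local Notation mu := (@lebesgue_measure R).
Local Notation D := `[0%R, (pi *+ 2)%R]%classic.

Let pi2_gt0 : 0 < pi *+ 2 :> R.
Proof. by rewrite mulrn_wgt0// pi_gt0. Qed.

Lemma lebesgue_measure_circle : mu D = (pi *+ 2)%:E.
Proof. by rewrite lebesgue_measure_itv /= lte_fin pi2_gt0 oppr0 addr0. Qed.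

(** Otherwise an interval of length [w] with endpoint [t] would lie in the set where g > l, whose
    measure is below [w]. *)
Lemma good_point_nearby (g : R -> \bar R) (l w t : R) :
  measurable_fun [set: R] g -> D t -> w <= pi ->
  (mu (D `&` [set s | l%:E < g s]) < w%:E)%E ->
  exists s, `|s - t| <= w /\ (g s <= l%:E)%E.
Proof.
move=> mg Dt wpi Ow; apply: contrapT => /forallNP H.
have {}H s : `|s - t| <= w -> (l%:E < g s)%E.
  by move=> st; rewrite ltNge; apply/negP => gs; exact: (H s).
have mO : measurable (D `&` [set s | (l%:E < g s)%E]).
  apply: measurableI => //; have := mg measurableT _ (@emeasurable_itv R `]l%:E, +oo[).
  rewrite setTI; congr measurable; apply/seteqP; split=> s /=;
    by rewrite in_itv/= andbT.
have w0 : 0 < w.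
  by rewrite -lte_fin; apply: le_lt_trans Ow.
(* The interval extends to the right of [t] when t <= pi and to the left otherwise; w <= pi keeps it
   inside [0, 2 pi]. *)
have [a [H1 H2]] : exists a, 0 <= a /\ a + w <= pi *+ 2 /\ a <= t <= a + w.
  move: Dt; rewrite /= in_itv/= => /andP[t0 t2].
  have [tpi|tpi] := leP t pi.
    by exists t; rewrite mulr2n; split=> //; lra.
  by exists (t - w); split; [lra|rewrite mulr2n in t2 *; lra].
move: Ow; rewrite ltNge => /negP; apply.
have <- : mu `[a, a + w]%classic = w%:E.
  rewrite lebesgue_measure_itv /= lte_fin ltrDl w0.
  by rewrite -EFinD addrAC subrr add0r.
apply: le_measure; rewrite ?inE//.
move=> s /=; rewrite in_itv/= => /andP[as1 as2]; split.
  by rewrite in_itv/=; apply/andP; split; lra.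
by apply: H; rewrite ler_norml; lra.
Qed.

(** Parseval is applied to a partial sum that contains the given frequencies and is uniformly within
    [e] of the Poisson extension. Its squared modulus is at most (b + e)^2 <= 2 b^2 + 2 e^2. *)
Lemma bessel_le (f : circle_dist R) (r : R) (r01 : 0 <= r < 1) (b : R -> R)
    (e : R) (n0 : nat) :
  measurable_fun [set: R] b ->
  {in D, forall t, normc (poisson_ext f (polar R r r01 t)) <= b t} -> 0 < e ->
  ((pi *+ 2 * \sum_(m <- sym_range n0)
      normc ((r ^+ `|m|%N)%:C%C * fourier_coef f m) ^+ 2)%:E <=
   2%:E * \int[mu]_(t in D) (b t ^+ 2)%:E + (2 * e ^+ 2 * (pi *+ 2))%:E)%E.
Proof.
move=> mb ub e0.
have [n nn0 Hn] := poisson_ext_approx f r r01 n0 e e0.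
pose d m := (r ^+ `|m|%N)%:C%C * fourier_coef f m.
have qE t : fourier_psum f r t n =
    \sum_(m <- sym_range n) d m * expi (- (m%:~R * t)).
  by apply: eq_bigr => m _; rewrite /d mulrAC.
apply: (@le_trans _ _ (pi *+ 2 * \sum_(m <- sym_range n) normc (d m) ^+ 2)%:E).
  rewrite lee_fin ler_wpM2l ?(ltW pi2_gt0)//.
  apply: (ler_sum_uniq_sub R _ _ _ predT (fun m => normc (d m) ^+ 2)) => //;
    try exact: uniq_sym_range.
    by move=> m; rewrite !mem_sym_range => /leq_trans; exact.
  by move=> m _; exact: sqr_ge0.
rewrite -(parseval_trig R _ _ (uniq_sym_range n)).
have mb2 : measurable_fun D (fun t => (b t ^+ 2)%:E).
  apply/measurable_EFinP/measurable_funX.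
  exact: measurable_funS mb.
have mD : measurable (D : set R) by exact: measurable_itv.
have -> : ((2 * e ^+ 2 * (pi *+ 2))%:E = \int[mu]_(t in D) (2 * e ^+ 2)%:E)%E.
  by rewrite integral_cst// EFinM; congr (_ * _)%E; exact/esym/lebesgue_measure_circle.
rewrite -ge0_integralZl_EFin//; last by move=> t _; rewrite lee_fin sqr_ge0.
have p0 (t : R) : D t -> (0 <= 2%:E * (b t ^+ 2)%:E)%E.
  by move=> _; rewrite -EFinM lee_fin mulr_ge0// sqr_ge0.
have c0 (t : R) : D t -> (0 <= (2 * e ^+ 2)%:E)%E.
  by move=> _; rewrite lee_fin mulr_ge0// sqr_ge0.
have mb2' : measurable_fun D (fun t => 2%:E * (b t ^+ 2)%:E)%E.
  exact: measurable_funeM.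
rewrite -ge0_integralD//.
apply: ge0_le_integral => //.
- by move=> t _; rewrite lee_fin sqr_ge0.
- apply/measurable_EFinP; apply: measurable_funTS.
  apply: continuous_measurable_fun.
  exact: continuous_normc_psum_sqr.
- by apply: emeasurable_funD.
move=> t Dt; rewrite -EFinM -EFinD lee_fin.
have bt := ub t (mem_set Dt); have := Hn t; rewrite qE.
set q := \sum_(_ <- _) _; set u := poisson_ext _ _ in bt * => uq.
have qu : normc q <= b t + e.
  have -> : q = u + - (u - q) by ring.
  apply: (le_trans (le_normcD _ _)); rewrite lerD//.
  by rewrite (_ : normc (- _) = normc (u - q))// normcN.
have q0 := normc_ge0 R q; have b0 : 0 <= b t by apply: le_trans bt; exact: normc_ge0.
have : normc q ^+ 2 <= (b t + e) ^+ 2.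
  by rewrite lerXn2r ?nnegrE// addr_ge0// ltW.
have := sqr_ge0 (b t - e).
by move: (normc q) (b t) => x y; nra.
Qed.

End Bessel.

Section DistributionEstimate.
Context {R : realType} (alpha : R) (alpha_gt1 : 1 < alpha).
Local Notation mu := (@lebesgue_measure R).
Local Notation D := `[0%R, (pi *+ 2)%R]%classic.

Let trunc_ratio (f : circle_dist R) (l t : R) : R :=
  etrunc l (nt_max alpha f t) / l.

Let measurable_trunc_ratio f l : 0 < l ->
  measurable_fun [set: R] (fun t => (trunc_ratio f l t ^+ 2)%:E).
Proof.
move=> l0; apply/measurable_EFinP; apply: measurable_funX.
apply: measurable_funM; last exact: measurable_cst.
by apply: measurable_etrunc; exact: measurable_nt_max.
Qed.

(* With [r = 1 - s], a point of [nt_max <= l] lies within [kappa * s] of every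
   [t], so [poisson_ext f (polar r t)] is bounded both by [l] and by [nt_max]
   at [t]. *)
Let small_frequencies (f : circle_dist R) (l s v h : R) (n0 : nat) :
  let kappa := (alpha - 1) / 2 in
  0 < l -> 0 < s -> s <= 2^-1 -> kappa * s <= pi -> v < kappa * s -> 0 < h <= 1 ->
  (\int[mu]_(t in D) (trunc_ratio f l t ^+ 2)%:E = v%:E)%E ->
  \sum_(m <- sym_range n0)
    normc (((1 - s) ^+ `|m|%N)%:C%C * fourier_coef f m) ^+ 2 <= l ^+ 2 * (v + 2 * h).
Proof.
move=> kappa l0 s0 s12 kpi vk /andP[h0 h1] Iv.
have pi1 : 1 <= pi :> R by apply: le_trans (@pi_ge2 R); rewrite ler1n.
have r01 : 0 <= 1 - s < 1 by apply/andP; split; lra.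
have mg := measurable_nt_max alpha f.
have g0 := nt_max_ge0 alpha alpha_gt1 f.
have mD : measurable (D : set R) by exact: measurable_itv.
have mI := @measurable_trunc_ratio f l l0.
have mID : measurable_fun D (fun t => (trunc_ratio f l t ^+ 2)%:E).
  exact: measurable_funTS.
(* Chebyshev's inequality: the truncated ratio equals 1 where [nt_max] exceeds [l]. *)
have Ov : (mu (D `&` [set t | l%:E < nt_max alpha f t]) <= v%:E)%E.
  have mO : measurable [set t | (l%:E < nt_max alpha f t)%E].
    have := mg measurableT _ (@emeasurable_itv R `]l%:E, +oo[).
    rewrite setTI; congr measurable; apply/seteqP; split=> t /=;
      by rewrite in_itv/= andbT.
  rewrite -Iv setIC -integral_indic//; apply: ge0_le_integral => //.
  - by apply: measurable_funTS; apply/measurable_EFinP; exact: measurable_indic.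
  - move=> t _; rewrite lee_fin indicE; case: (boolP (t \in _)) => [|_].
      rewrite inE /= => lt.
      by rewrite /trunc_ratio etrunc_gt// divff ?gt_eqF// expr1n.
    exact: sqr_ge0.
have ub : {in D, forall t,
    normc (poisson_ext f (polar R (1 - s) r01 t)) <= etrunc l (nt_max alpha f t)}.
  move=> t /set_mem Dt.
  have Ov' : (mu (D `&` [set t | l%:E < nt_max alpha f t]) < (kappa * s)%:E)%E.
    by apply: le_lt_trans Ov _; rewrite lte_fin.
  have [s' [s't gs']] := good_point_nearby _ l _ t mg Dt kpi Ov'.
  have ks : kappa * s < (alpha - 1) * (1 - (1 - s)).
    have : 0 < (alpha - 1) * s by rewrite mulr_gt0// subr_gt0.
    by rewrite /kappa; lra.
  apply: le_etrunc => //.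
    rewrite -lee_fin; apply: le_trans gs'; apply: poisson_ext_le_nt_max.
    exact: le_lt_trans s't ks.
  apply: poisson_ext_le_nt_max; rewrite subrr normr0.
  by rewrite mulr_gt0 ?subr_gt0//; lra.
have mb : measurable_fun [set: R] (fun t => etrunc l (nt_max alpha f t)).
  exact: measurable_etrunc.
(* An approximation error of [l * h] scales like the main term, and h^2 <= h makes its contribution
   linear in [h]. *)
have := bessel_le f (1 - s) r01 _ (l * h) n0 mb ub (mulr_gt0 l0 h0).
have -> : (\int[mu]_(t in D) (etrunc l (nt_max alpha f t) ^+ 2)%:E =
    (l ^+ 2 * v)%:E)%E.
  rewrite EFinM -Iv -ge0_integralZl_EFin//; last first.
  - exact: sqr_ge0.
  - by move=> t _; rewrite lee_fin sqr_ge0.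
  apply: eq_integral => t _; rewrite -EFinM /trunc_ratio expr_div_n.
  by rewrite mulrCA divff ?mulr1// expf_eq0/= gt_eqF.
rewrite -EFinM -EFinD lee_fin; set S := \sum_(_ <- _) _.
rewrite exprMn mulr2n => H.
have v0 : 0 <= v.
  by rewrite -lee_fin -Iv integral_ge0// => t _; rewrite lee_fin sqr_ge0.
have l20 : 0 < l ^+ 2 by rewrite exprn_gt0.
have S0 : 0 <= S by apply: sumr_ge0 => m _; exact: sqr_ge0.
have pi0 : 0 < pi :> R by exact: pi_gt0.
move: H; set L := l ^+ 2 in l20 *; rewrite expr2 => H.
have {}H : pi * S <= L * v + 2 * pi * (L * (h * h)) by lra.
have : pi * (L * (h * h)) <= pi * (L * h).
  by rewrite !ler_wpM2l ?(ltW pi0) ?(ltW l20)// ler_piMl// ltW.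
have : L * v <= pi * (L * v) by rewrite ler_peMl// mulr_ge0// ltW.
move=> H1 H2; have : pi * S <= pi * (L * v + 2 * (L * h)) by lra.
rewrite ler_pM2l//; lra.
Qed.

Lemma coef_distribution_le : exists2 C : R, 0 < C & forall (f : circle_dist R) l n0,
  0 < l ->
  ((\sum_(m <- sym_range n0 | (m != 0) && (l < normc (m%:~R * fourier_coef f m)))
     (m%:~R ^+ 2)^-1)%:E <=
   C%:E * \int[mu]_(t in D) ((etrunc l (nt_max alpha f t) / l) ^+ 2)%:E)%E.
Proof.
pose kappa := (alpha - 1) / 2.
have k0 : 0 < kappa by rewrite divr_gt0// subr_gt0.
have pi0 : 0 < pi :> R by exact: pi_gt0.
(* Below [s0] the radius 1 - s is at least 1/2 and kappa s is at most pi, as [small_frequencies]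
   requires. *)
pose s0 := Num.min 2^-1 (pi / kappa).
have s00 : 0 < s0 by rewrite lt_min invr_gt0 ltr0n divr_gt0.
(* The three terms come from the low frequencies, from the tail bound 8 s, and from the case s >=
   s0. In [C2], 16 adds 8 from the low frequencies and 8 from the tail. *)
pose C1 := 4 + 8 / kappa + 8 / s0 / kappa.
pose C2 := 16 + 8 / s0.
have [K1 K2 K3] : [/\ 0 < 8 / kappa, 0 < 8 / s0 / kappa & 0 < 8 / s0].
  have n8 : 0 < 8 :> R by rewrite ltr0n.
  by split; [exact: divr_gt0|apply: divr_gt0 => //; exact: divr_gt0|exact: divr_gt0].
exists C1 => [|f l n0 l0]; first by rewrite /C1; lra.
have g0 := nt_max_ge0 alpha alpha_gt1 f.
have [v Iv] : exists v, (\int[mu]_(t in D) (trunc_ratio f l t ^+ 2)%:E = v%:E)%E.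
  exists (fine (\int[mu]_(t in D) (trunc_ratio f l t ^+ 2)%:E)%E).
  rewrite fineK// ge0_fin_numE; last first.
    by apply: integral_ge0 => t _; rewrite lee_fin sqr_ge0.
  have mD : measurable (D : set R) by exact: measurable_itv.
  apply: (@le_lt_trans _ _ (\int[mu]_(t in D) 1%:E)%E).
    apply: ge0_le_integral => //.
    - by move=> t _; rewrite lee_fin sqr_ge0.
    - by apply: measurable_funTS; exact: measurable_trunc_ratio.
    - move=> t _; rewrite lee_fin exprn_ile1//.
        by rewrite divr_ge0 ?etrunc_ge0// ltW.
      by rewrite ler_pdivrMr// mul1r etrunc_le.
  rewrite integral_cst// mul1e.
  by rewrite [X in (X < _)%E](lebesgue_measure_circle : _ = (pi *+ 2)%:E) ltry.
rewrite [X in (_ <= _ * X)%E](_ : _ = v%:E)%E; last exact: Iv.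
rewrite -EFinM lee_fin.
have v0 : 0 <= v.
  by rewrite -lee_fin -Iv integral_ge0// => t _; rewrite lee_fin sqr_ge0.
set S := (X in X <= _).
(* The slack [h] makes s positive and v < kappa s strict even when v = 0; it then tends to 0. *)
suff H (h : R) : 0 < h <= 1 -> S <= C1 * v + C2 * h.
  apply/ler_addgt0Pr => e e0; pose h := Num.min 1 (e / C2).
  have C20 : 0 < C2 by rewrite /C2; lra.
  have h01 : 0 < h <= 1 by rewrite lt_min ltr01 divr_gt0// ge_min lexx.
  apply: (le_trans (H _ h01)); rewrite lerD2l mulrC -ler_pdivlMr//.
  by rewrite ge_min lexx orbT.
move=> h01; have /andP[h0 h1] := h01.
pose s := v / kappa + h.
have vk0 : 0 <= v / kappa by rewrite divr_ge0// ltW.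
have ss : 0 < s by rewrite /s; lra.
have tail (a : R) : 0 < a -> \sum_(m <- sym_range n0 |
    ((m != 0) && (l < normc (m%:~R * fourier_coef f m))) && (a < `|m|%N%:R))
     (m%:~R ^+ 2)^-1 <= 4 / a.
  move=> a0; have H := sum_inv_sqr_tail R a n0 a0.
  apply: (le_trans _ H).
  rewrite big_mkcond [leRHS]big_mkcond; apply: ler_sum => m _.
  case: ifPn => [/andP[/andP[-> _] ->]//|_]; case: ifPn => // _.
  by rewrite invr_ge0 sqr_ge0.
(* For large [s] the total mass of m^-2 suffices: the threshold 1/2 keeps all nonzero integers, so
   the tail bound gives 8 <= (8 / s0) s. *)
have [s0s|ss0] := leP s0 s.
  have S8 : S <= 8.
    apply: (@le_trans _ _ (4 / 2^-1)); last by rewrite invrK; lra.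
    have n2 : 0 < 2^-1 :> R by rewrite invr_gt0.
    apply: le_trans (tail _ n2).
    rewrite /S big_mkcond [leRHS]big_mkcond; apply: ler_sum => m _.
    case: ifPn => //= /andP[m0 _]; rewrite ifT//.
    apply: (@lt_le_trans _ _ 1); first by lra.
    by rewrite ler1n absz_gt0.
  apply: (le_trans S8).
  have : 8 <= 8 / s0 * s by rewrite mulrAC ler_pdivlMr// ler_wpM2l.
  have -> : 8 / s0 * s = 8 / s0 / kappa * v + 8 / s0 * h.
    by rewrite /s; field; rewrite !gt_eqF.
  have : 0 <= 8 / kappa * v by rewrite mulr_ge0// ltW.
  rewrite /C1 /C2; lra.
have [s12 skpi] : s <= 2^-1 /\ kappa * s <= pi.
  move: ss0; rewrite lt_min => /andP[? sk]; split; first exact: ltW.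
  by rewrite mulrC -ler_pdivlMr// ltW.
have vks : v < kappa * s.
  have -> : kappa * s = v + kappa * h by rewrite /s; field; rewrite gt_eqF.
  by rewrite ltrDl mulr_gt0.
have := small_frequencies f l s v h n0 l0 ss s12 skpi vks h01 Iv.
set B := \sum_(_ <- _) _ => HB.
rewrite /S (bigID (fun m : int => (2 * s)^-1 < `|m|%N%:R)) /=.
have s20 : 0 < (2 * s)^-1 by rewrite invr_gt0 mulr_gt0.
have T1 : 4 / (2 * s)^-1 = 8 * s by rewrite invrK; ring.
have := tail _ s20; rewrite T1; set S1 := \sum_(_ <- _ | _) _ => HS1.
set S2 := \sum_(_ <- _ | _) _.
(* Here l < |m| |c_m| gives m^-2 <= |c_m|^2 / l^2, and 4 compensates the damping (1 - s)^|m|, which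
   Bernoulli's inequality keeps at least 1/2 for |m| <= 1/(2s). *)
have HS2 : S2 <= 4 / l ^+ 2 * B.
  rewrite /S2 /B big_mkcond mulr_sumr; apply: ler_sum => m _.
  have l20 : 0 < l ^+ 2 by rewrite exprn_gt0.
  case: ifPn => [|_]; last by rewrite mulr_ge0 ?sqr_ge0// divr_ge0// ltW.
  rewrite -leNgt => /andP[/andP[m0 lm] ms].
  have mR0 : 0 < `|m%:~R : R| by rewrite normr_gt0 intr_eq0.
  have half : 2^-1 <= (1 - s) ^+ `|m|%N.
    have sm : s * `|m|%N%:R <= 2^-1.
      have := ms; rewrite -(ler_pM2l (mulr_gt0 (ltr0n R 2) ss)) divff; last first.
        by rewrite gt_eqF// mulr_gt0.
      lra.
    apply: (@le_trans _ _ (1 - s * `|m|%N%:R)); first by lra.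
    have bern k : 1 - s * k%:R <= (1 - s) ^+ k.
      elim: k => [|k IH]; first by rewrite mulr0 subr0 expr0.
      have k0' : 0 <= k%:R :> R by [].
      rewrite exprS -natr1; apply: (@le_trans _ _ ((1 - s) * (1 - s * k%:R))).
        nra.
      by rewrite ler_wpM2l//; lra.
    exact: bern.
  rewrite normcM /= expr0n addr0 sqrtr_sqr ger0_norm; last first.
    by apply: le_trans half; rewrite invr_ge0.
  have -> : m%:~R ^+ 2 = `|m%:~R : R| ^+ 2 :> R by rewrite real_normK ?num_real.
  move: lm; rewrite normc_intrM.
  set c := normc _; set M := `|_| in mR0 *; set q := _ ^+ `|m|%N in half *.
  move=> lMc.
  have c0 : 0 <= c by exact: normc_ge0.
  rewrite mulrAC ler_pdivlMr// mulrC -[X in _ <= X]mulr1.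
  rewrite ler_pdivrMr ?exprn_gt0//.
  have H1 : l ^+ 2 <= (M * c) ^+ 2 
    by rewrite lerXn2r ?nnegrE ?mulr_ge0 ?(ltW mR0) ?(ltW l0) ?(ltW lMc).
  have H2 : 1 <= 4 * q ^+ 2 by rewrite expr2; nra.
  have H3 : 0 <= (M * c) ^+ 2 by exact: sqr_ge0.
  have -> : 4 * (q * c) ^+ 2 * 1 * M ^+ 2 = 4 * q ^+ 2 * (M * c) ^+ 2 by ring.
  nra.
have {}HS2 : S2 <= 4 * (v + 2 * h).
  apply: (le_trans HS2); rewrite mulrAC ler_pdivrMr ?exprn_gt0//.
  by rewrite -mulrA ler_wpM2l// mulrC.
have : 8 * s = 8 / kappa * v + 8 * h by rewrite /s; field; rewrite gt_eqF.
have : 0 <= 8 / s0 / kappa * v by rewrite mulr_ge0// ltW.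
have : 0 <= 8 / s0 * h by rewrite mulr_ge0// ltW.
rewrite /C1 /C2; lra.
Qed.

End DistributionEstimate.

(** * Summation over dyadic levels *)

Lemma Psi0_le_dyadic (R : realType) (l0 x : R) (n : nat) :
  0 < l0 -> 0 <= x -> x <= 2 ^+ n * l0 ->
  Psi0 x <= l0 + \sum_(j < n) Psi0 (2 ^+ j.+1 * l0) * (2 ^+ j * l0 < x)%R%:R.
Proof.
move=> l00 x0; elim: n => [|n IH] xn.
  rewrite big_ord0 addr0 (le_trans (Psi0_le_id _ x0))//.
  by rewrite expr0 mul1r in xn.
have P0 j : 0 <= Psi0 (2 ^+ j * l0) by rewrite Psi0_ge0// mulr_ge0 ?exprn_ge0// ltW.
rewrite big_ord_recr /=; case: ltP => [nx|xn'].
  rewrite mulr1 (le_trans (Psi0_homo _ _ x0 xn))// addrA lerDr addr_ge0 ?(ltW l00)//.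
  by apply: sumr_ge0 => j _; rewrite mulr_ge0.
by rewrite mulr0 addr0; exact: IH.
Qed.

(** The lowest level [l0] keeps the dyadic sum finite. Its cost is [l0] times the sum of m^-2 over
    nonzero m, at most 8 l0. *)
Lemma fourier_Psi0_sum_le (R : realType) (alpha : R) : 1 < alpha ->
  exists2 C : R, 0 < C & forall (f : circle_dist R) (n0 : nat) (l0 : R), 0 < l0 ->
  ((\sum_(m <- sym_range n0 | m != 0)
      Psi0 (normc (m%:~R * fourier_coef f m)) / m%:~R ^+ 2)%:E <=
   (8 * l0)%:E + C%:E * \int[@lebesgue_measure R]_(t in `[0%R, (pi *+ 2)%R])
                          er_map (@Psi0 R) (nt_max alpha f t))%E.
Proof.
move=> alpha_gt1.
have [C1 C10 HC1] := coef_distribution_le alpha alpha_gt1.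
have [C2 C20 HC2] := @Psi0_dyadic_sum R.
exists (C1 * C2) => [|f n0 l0 l00]; first exact: mulr_gt0.
pose x m := normc (m%:~R * fourier_coef f m).
have x0 m : 0 <= x m by exact: normc_ge0.
(* Large enough that every [x m] is at most 2^n l0, since n < 2^n. *)
pose n := (Num.truncn ((\sum_(m <- sym_range n0) x m) / l0)).+1.
have xn m : m \in sym_range n0 -> x m <= 2 ^+ n * l0.
  move=> mn; apply: (@le_trans _ _ (\sum_(m <- sym_range n0) x m)).
    rewrite (bigD1_seq m) ?uniq_sym_range//= lerDl.
    by apply: sumr_ge0 => k _; exact: x0.
  rewrite -ler_pdivrMr//; apply/ltW/(lt_le_trans (truncnS_gt _)).
  by rewrite -natrX ler_nat ltnW// ltn_expl.
pose l j := 2 ^+ j * l0.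
have lpos j : 0 < l j by rewrite mulr_gt0// exprn_gt0.
have P0 j : 0 <= Psi0 (l j) by rewrite Psi0_ge0// ltW.
pose A j := \sum_(m <- sym_range n0 | (m != 0) && (l j < x m)) (m%:~R ^+ 2)^-1 : R.
have S1 : \sum_(m <- sym_range n0 | m != 0) Psi0 (x m) / m%:~R ^+ 2 <=
    8 * l0 + \sum_(j < n) Psi0 (l j.+1) * A j.
  apply: (@le_trans _ _ (\sum_(m <- sym_range n0 | m != 0)
      (l0 + \sum_(j < n) Psi0 (l j.+1) * (l j < x m)%R%:R) / m%:~R ^+ 2)).
    rewrite big_seq_cond [leRHS]big_seq_cond; apply: ler_sum => m /andP[mn _].
    by rewrite ler_wpM2r ?invr_ge0 ?sqr_ge0// Psi0_le_dyadic// xn.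
  under eq_bigr do rewrite mulrDl.
  rewrite big_split /= lerD//.
    rewrite -mulr_sumr mulrC ler_wpM2r// ?(ltW l00)//.
    apply: (@le_trans _ _ (4 / 2^-1)); last by rewrite invrK; lra.
    have n2 : 0 < 2^-1 :> R by rewrite invr_gt0.
    apply: le_trans (sum_inv_sqr_tail R _ n0 n2).
    rewrite big_mkcond [leRHS]big_mkcond; apply: ler_sum => m _.
    case: ifPn => //= m0; rewrite ifT//.
    apply: (@lt_le_trans _ _ 1); first by lra.
    by rewrite ler1n absz_gt0.
  under eq_bigr do rewrite mulr_suml.
  rewrite exchange_big /=; apply: ler_sum => j _.
  rewrite /A big_mkcondr mulr_sumr; apply: ler_sum => m _.
  by case: ifPn => _; rewrite ?mulr1 ?mulr0 ?mul0r.
set g := nt_max alpha f.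
have g0 : forall t, (0 <= g t)%E := nt_max_ge0 alpha alpha_gt1 f.
have mg : measurable_fun [set: R] g by exact: measurable_nt_max.
pose h j t : \bar R := ((etrunc (l j) (g t) / l j) ^+ 2)%:E.
have mD : measurable (`[0%R, (pi *+ 2)%R]%classic : set R) by exact: measurable_itv.
have h0 j t : (0 <= h j t)%E by rewrite lee_fin sqr_ge0.
have mh j : measurable_fun [set: R] (h j).
  apply/measurable_EFinP; apply: measurable_funX.
  apply: measurable_funM; last exact: measurable_cst.
  exact: measurable_etrunc.
have mPh j : measurable_fun `[0%R, (pi *+ 2)%R] (fun t => (Psi0 (l j.+1))%:E * h j t)%E.
  by apply: measurable_funTS; exact: measurable_funeM.
apply: (@le_trans _ _ (8 * l0 + \sum_(j < n) Psi0 (l j.+1) * A j)%:E).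
  by rewrite lee_fin.
rewrite EFinD leeD2l// EFinM -muleA.
(* With the sum over levels under the integral, [Psi0_dyadic_sum] applies pointwise to the value of
   the maximal function. *)
apply: (@le_trans _ _ (C1%:E * \int[@lebesgue_measure R]_(t in `[0%R, (pi *+ 2)%R])
    \sum_(j < n) ((Psi0 (l j.+1))%:E * h j t))%E).
  rewrite ge0_integral_sum//; last 2 first.
    by move=> j; exact: mPh.
    by move=> j t _; rewrite mule_ge0// lee_fin.
  rewrite ge0_sume_distrr; last first.
    by move=> j _; apply: integral_ge0 => t _; rewrite mule_ge0// lee_fin.
  rewrite -sumEFin; apply: lee_sum => j _.
  rewrite ge0_integralZl_EFin//; last exact: (measurable_funTS (mh j)).
  rewrite [leRHS]muleCA EFinM; apply: lee_wpmul2l; first by rewrite lee_fin.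
  exact: HC1.
rewrite lee_wpmul2l ?lee_fin ?(ltW C10)//.
have mPsi : measurable_fun [set: R] (fun t => er_map (@Psi0 R) (g t)).
  exact: measurable_er_map_Psi0.
have Psig0 t : (0 <= er_map (@Psi0 R) (g t))%E.
  by have := g0 t; case: (g t) => //= y; rewrite !lee_fin; exact: Psi0_ge0.
rewrite -ge0_integralZl_EFin//; last 2 first.
- exact: (measurable_funTS mPsi).
- exact: ltW.
apply: ge0_le_integral => //.
- by move=> t _; apply: sume_ge0 => j _; rewrite mule_ge0// lee_fin.
- by apply: emeasurable_sum => j; exact: mPh.
- by apply: measurable_funeM; exact: (measurable_funTS mPsi).
move=> t _; rewrite /h; have := g0 t; case: (g t) => [y| |]//.
  rewrite lee_fin => y0 /=.
  under eq_bigr do rewrite -EFinM etrunc_fin.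
  by rewrite sumEFin -EFinM lee_fin; exact: HC2.
(* Where the maximal function is +oo, so is the right-hand side. *)
by move=> _ /=; rewrite gt0_muley ?leey ?lte_fin.
Qed.

Theorem theorem27 (R : realType) (alpha : R) (alpha_gt1 : 1 < alpha) :
  exists2 C : R, 0 < C &
    forall f : circle_dist R, Hlog alpha f ->
      (\esum_(n in [set n : int | n != 0%R])
          (Psi0 (normc (n%:~R * fourier_coef f n)) / n%:~R ^+ 2)%:E
        <= C%:E * \int[@lebesgue_measure R]_(theta in `[0%R, (pi *+ 2)%R])
                    er_map (@Psi0 R) (nt_max alpha f theta))%E.
Proof.
have [C C0 HC] := fourier_Psi0_sum_le R alpha alpha_gt1.
exists C => // f _.
apply: ge_ereal_sup => _ [A [finA sA] <-].
rewrite fsbig_finite//=.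
pose F m := Psi0 (normc (m%:~R * fourier_coef f m)) / m%:~R ^+ 2 : R.
have F0 m : 0 <= F m by rewrite divr_ge0 ?sqr_ge0// Psi0_ge0// normc_ge0.
set s : seq int := finmap.enum_fset (fset_set A).
have us : uniq s by exact: finmap.fset_uniq.
(* A crude bound for all |m| in the finite set, so that a symmetric range contains it. *)
pose n0 := (\sum_(m <- s) `|m|)%N.
have sn m : m \in s -> m \in sym_range n0.
  by move=> ms; rewrite mem_sym_range /n0 (bigD1_seq m)//= leq_addr.
apply: (@le_trans _ _ (\sum_(m <- sym_range n0 | m != 0) F m)%:E).
  rewrite sumEFin lee_fin; apply: ler_sum_uniq_sub => //.
  - exact: uniq_sym_range.
  - by move=> m ms; apply: sA; apply: set_mem; rewrite -(in_fset_set finA).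
  - by move=> m _; exact: F0.
(* The lowest level is arbitrary: l0 = e / 8 turns its cost into [e]. *)
apply/lee_addgt0Pr => e e0.
have e8 : 0 < e / 8 by rewrite divr_gt0.
have := HC f n0 _ e8; rewrite addeC (_ : 8 * (e / 8) = e)//.
by rewrite mulrC mulfVK.
Qed.
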